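(* Let $X$ be a connected locally finite hyperbolic graph, let $G\leq\mathrm{Aut}(X)$ be countable, and let $(T,\beta)$ be a $G$-invariant tree-decomposition of $X$ such that every bag $\beta(t)$, $t\in V(T)$, induces a connected subgraph of $X$, every adhesion set is finite, and $G\backslash E(T)$ is finite. For $t\in V(T)$ put $X_t:=X[\beta(t)]$ and $G_t:=\mathrm{Stab}_G(t)$. (a) If $E_G^{\partial T}$ is Borel hyperfinite and $E_{G_t}^{\partial X_t}$ is Borel hyperfinite for every $t\in V(T)$, then $E_G^{\partial X}$ is Borel hyperfinite. (b) Suppose in addition that for every edge $e=uv\in E(T)$ each of the two sets $V_u^e$ and $V_v^e$ contains a tail of every ray of some end of $X$ (that is, there are an end $\omega$ of $X$ such that every ray in $\omega$ has a tail in $V_u^e$, and an end $\omega'$ of $X$ such that every ray in $\omega'$ has a tail in $V_v^e$). Then the converse of (a) also holds: if $E_G^{\partial X}$ is Borel hyperfinite, then $E_G^{\partial T}$ is Borel hyperfinite and $E_{G_t}^{\partial X_t}$ is Borel hyperfinite for every $t\in V(T)$.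
   Context: Graphs are simple and carry their path metrics; ''hyperbolic'' means Gromov hyperbolic. $\partial X$ is the Gromov boundary of $X$: equivalence classes of geodesic rays, two rays being equivalent if they have finite Hausdorff distance, with the usual topology. A ray is a one-way infinite simple path; two rays are equivalent if, after deleting any finite vertex set, they have tails in the same component; an end is an equivalence class of rays. For a tree $T$, $\partial T$ is its set of ends with the end topology (basic open sets: the ends all of whose rays have tails in $C$, for $C$ a component of $T$ minus a finite vertex set); it is standard Borel when $T$ is countable. A tree-decomposition of a graph $X$ is a pair $(T,\beta)$ with $T$ a tree and $\beta:V(T)\to\mathcal P(V(X))$ such that: (1) $V(X)=\bigcup_{t}\beta(t)$; (2) every edge of $X$ has both endpoints in some bag $\beta(t)$; (3) for every $x\in V(X)$ the set $\{t\in V(T):x\in\beta(t)\}$ is a connected subtree of $T$. The adhesion set of $e=uv\in E(T)$ is $S_e=\beta(u)\cap\beta(v)$. For $G\le\mathrm{Aut}(X)$, $(T,\beta)$ is $G$-invariant if $G$ acts on $T$ by tree automorphisms and $\beta(gt)=g\beta(t)$ for all $g\in G$, $t\in V(T)$. $X[\beta(t)]$ is the induced subgraph; $G_t$ acts on it. For $e=uv\in E(T)$, let $T_u^e,T_v^e$ be the components of $T-e$ containing $u,v$ respectively, and $V_u^e:=\bigcup_{s\in V(T_u^e)}\beta(s)$, $V_v^e:=\bigcup_{s\in V(T_v^e)}\beta(s)$. For a countable group $H$ acting by Borel automorphisms on a standard Borel space $Y$, $E_H^Y$ is the orbit equivalence relation. A countable Borel equivalence relation is Borel hyperfinite if it is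 an increasing union of a sequence of finite Borel equivalence relations (Borel equivalence relations all of whose classes are finite). *)

(* Defs.v *)
From HB Require Import structures.
From mathcomp Require Import all_boot all_order all_algebra.
From mathcomp Require Import all_classical topology measurable_structure.
From Stdlib Require RelationClasses.

Set Implicit Arguments.
Unset Strict Implicit.
Unset Printing Implicit Defensive.

Import Order.TTheory GRing.Theory Num.Theory.
Local Open Scope classical_set_scope.

Record graph := Graph {
  vert :> choiceType;
  adj : rel vert;
  adj_sym : symmetric adj;
  adj_irr : irreflexive adj
}.

Section Induced.
Variables (X : graph) (A : set X).

Definition induced_adj : rel A := fun x y => adj (val x) (val y).

Lemma induced_adj_sym : symmetric induced_adj.
Proof. by move=> x y; exact: adj_sym. Qed.

Lemma induced_adj_irr : irreflexive induced_adj.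
Proof. by move=> x; exact: adj_irr. Qed.

Definition induced : graph := Graph induced_adj_sym induced_adj_irr.
End Induced.

Section DeleteEdge.
Variables (X : graph) (u v : X).

Definition del_adj : rel X := fun x y =>
  adj x y && ~~ ((x == u) && (y == v) || (x == v) && (y == u)).

Lemma del_adj_sym : symmetric del_adj.
Proof.
by move=> x y; rewrite /del_adj adj_sym orbC (andbC (x == v)) (andbC (x == u)).
Qed.

Lemma del_adj_irr : irreflexive del_adj.
Proof. by move=> x; rewrite /del_adj adj_irr. Qed.

Definition del_edge : graph := Graph del_adj_sym del_adj_irr.
End DeleteEdge.

Section GraphNotions.
Variable X : graph.

Definition edges : set (set X) :=
  [set e | exists u v : X, adj u v /\ e = [set u; v]].

Definition reach (x : X) : set X :=
  [set y | exists p : seq X, path (@adj X) x p /\ last x p = y].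

(** For [x] outside [S], the component of [X - S] containing [x]. *)
Definition component_off (S : set X) (x : X) : set X :=
  [set y | exists p : seq X,
     [/\ path (@adj X) x p, last x p = y & forall z, z \in x :: p -> ~ S z]].

(** The empty graph does not count as connected. *)
Definition connected_graph : Prop :=
  inhabited X /\ forall x y : X, reach x y.

Definition locally_finite : Prop :=
  forall x : X, finite_set [set y | adj x y].

(** [ucycle] accepts [:: x; y] for every edge [xy]; genuine cycles are the ones
    of length at least 3. *)
Definition is_tree : Prop :=
  connected_graph /\ forall c : seq X, ucycle (@adj X) c -> (size c < 3)%N.

Definition walk_length (x y : X) : pred nat := fun n =>
  `[< exists p : seq X, [/\ path (@adj X) x p, last x p = y & size p = n] >].

(** The value [0] between distinct components is a dummy: the path metric is
    only meant for connected graphs. *)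
Definition dist (x y : X) : nat :=
  match pselect (exists n, walk_length x y n) with
  | left h => ex_minn h
  | right _ => 0
  end.

Definition gromov_product (p x y : X) : rat :=
  (((dist p x)%:R + (dist p y)%:R - (dist x y)%:R) / 2%:R)%R.

Definition gromov_hyperbolic : Prop :=
  exists delta : rat, forall p x y z : X,
    (Num.min (gromov_product p x y) (gromov_product p y z) - delta
       <= gromov_product p x z)%R.

Definition ray (r : nat -> X) : Prop :=
  injective r /\ forall n, adj (r n) (r n.+1).

Definition has_tail_in (r : nat -> X) (A : set X) : Prop :=
  exists N, forall n, (N <= n)%N -> A (r n).

Definition end_equiv (r s : nat -> X) : Prop :=
  forall S : set X, finite_set S -> exists x : X,
    [/\ ~ S x, has_tail_in r (component_off S x)
      & has_tail_in s (component_off S x)].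

Definition geodesic_ray (r : nat -> X) : Prop :=
  forall m n, (m <= n)%N -> dist (r m) (r n) = (n - m)%N.

Definition finite_hausdorff (r s : nat -> X) : Prop :=
  exists D : nat, (forall m, exists n, (dist (r m) (s n) <= D)%N) /\
                  (forall n, exists m, (dist (r m) (s n) <= D)%N).

Definition is_class (P : (nat -> X) -> Prop)
    (R : (nat -> X) -> (nat -> X) -> Prop) (A : set (nat -> X)) : Prop :=
  exists2 r, P r & A = [set s | P s /\ R r s].

Definition ends : Type := {A : set (nat -> X) | is_class ray end_equiv A}.

Definition boundary : Type :=
  {A : set (nat -> X) | is_class geodesic_ray finite_hausdorff A}.

HB.instance Definition _ := gen_eqMixin ends.
HB.instance Definition _ := gen_choiceMixin ends.
HB.instance Definition _ := gen_eqMixin boundary.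
HB.instance Definition _ := gen_choiceMixin boundary.

Definition end_tails_in (w : ends) (A : set X) : Prop :=
  forall r, sval w r -> has_tail_in r A.

Definition end_basic : set (set ends) :=
  [set B | exists (S : set X) (x : X), [/\ finite_set S, ~ S x
     & B = [set w | end_tails_in w (component_off S x)]]].

(** The sets of [end_basic] are stable under pairwise intersection up to
    shrinking, so generating as a subbase or as a base is the same. *)
HB.instance Definition _ := @isSubBaseTopological.Build ends
  (set ends) end_basic id.

(** [boundary_nbhs p r xi]: the points [eta] such that, for some geodesic rays
    [a] in [xi] and [b] in [eta] issuing from [p], the liminf of the Gromov
    products [(a n | b n)_p] is at least [r]; as Gromov products are
    half-integers, this means that they are eventually at least [r].  In a
    proper hyperbolic space these sets, for a fixed [p], are a neighbourhood
    basis at [xi] of the usual topology, which does not depend on [p]. *)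
Definition boundary_nbhs (p : X) (r : nat) (xi : boundary) : set boundary :=
  [set eta | exists a b : nat -> X,
     [/\ sval xi a, sval eta b, a 0%N = p, b 0%N = p &
       exists N, forall n, (N <= n)%N ->
         (r%:R <= gromov_product p (a n) (b n))%R]].

Definition boundary_open : set_system boundary :=
  [set U | forall (p : X) (xi : boundary), U xi ->
     exists r : nat, boundary_nbhs p r xi `<=` U].

Lemma boundary_openT : boundary_open setT.
Proof. by move=> p xi _; exists 0%N. Qed.

Lemma boundary_openI : setI_closed boundary_open.
Proof.
move=> U V oU oV p xi [/(oU p)[r rU] /(oV p)[s sV]].
exists (maxn r s) => eta [a [b [xa eb ap bp [N HN]]]]; split.
- apply: rU; exists a, b; split=> //; exists N => n /HN; apply: le_trans.
  by rewrite ler_nat leq_maxl.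
- apply: sV; exists a, b; split=> //; exists N => n /HN; apply: le_trans.
  by rewrite ler_nat leq_maxr.
Qed.

Lemma boundary_open_bigU (I : Type) (f : I -> set boundary) :
  (forall i, boundary_open (f i)) -> boundary_open (\bigcup_i f i).
Proof.
move=> of_ p xi [i _ /(of_ i p)[r rf]].
by exists r => eta /rf fe; exists i.
Qed.

HB.instance Definition _ := @isOpenTopological.Build boundary
  boundary_open boundary_openT boundary_openI boundary_open_bigU.

End GraphNotions.

Record aut (X : graph) := Aut {
  aut_fun :> X -> X;
  aut_inv : X -> X;
  aut_funK : cancel aut_fun aut_inv;
  aut_invK : cancel aut_inv aut_fun;
  aut_adj : forall x y, adj (aut_fun x) (aut_fun y) = adj x y
}.

Section AutGroup.
Variable X : graph.
Implicit Types g h : aut X.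

Lemma aut_ext g h : g =1 h -> g = h.
Proof.
case: g h => [f f' fK f'K fA] [k k' kK k'K kA] /= /funext fk.
subst k; have ek : f' = k' by apply/funext => x; rewrite -{1}(k'K x) fK.
by subst k'; congr Aut; exact: Prop_irrelevance.
Qed.

HB.instance Definition _ := gen_eqMixin (aut X).
HB.instance Definition _ := gen_choiceMixin (aut X).

Definition aut_one : aut X :=
  @Aut X id id (fun=> erefl) (fun=> erefl) (fun _ _ => erefl).

Lemma aut_inv_adj g x y : adj (aut_inv g x) (aut_inv g y) = adj x y.
Proof. by rewrite -(aut_adj g) !aut_invK. Qed.

Definition aut_V g : aut X := Aut (@aut_invK X g) (@aut_funK X g) (aut_inv_adj g).

Lemma aut_mul_adj g h x y : adj ((g \o h) x) ((g \o h) y) = adj x y.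
Proof. by rewrite /= !aut_adj. Qed.

Definition aut_mul g h : aut X :=
  Aut (can_comp (@aut_funK X g) (@aut_funK X h))
      (can_comp (@aut_invK X h) (@aut_invK X g)) (aut_mul_adj g h).

Lemma aut_mulA : associative aut_mul.
Proof. by move=> f g h; exact: aut_ext. Qed.

Lemma aut_mul1 : left_id aut_one aut_mul.
Proof. by move=> g; exact: aut_ext. Qed.

Lemma aut_1mul : right_id aut_one aut_mul.
Proof. by move=> g; exact: aut_ext. Qed.

Lemma aut_mulV : left_inverse aut_one aut_V aut_mul.
Proof. by move=> g; apply: aut_ext => x /=; rewrite aut_funK. Qed.

Lemma aut_Vmul : right_inverse aut_one aut_V aut_mul.
Proof. by move=> g; apply: aut_ext => x /=; rewrite aut_invK. Qed.

HB.instance Definition _ := isGroup.Build (aut X)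
  aut_mulA aut_mul1 aut_1mul aut_mulV aut_Vmul.

Lemma aut_path g x p : path (@adj X) (g x) (map g p) = path (@adj X) x p.
Proof. by elim: p x => //= y p IH x; rewrite aut_adj IH. Qed.

Lemma aut_walk_length g x y : walk_length (g x) (g y) = walk_length x y.
Proof.
apply/funext => n; apply/asboolP/asboolP => -[p [pp lp sp]].
- exists (map (aut_inv g) p); split; last by rewrite size_map.
  + by rewrite -{1}(aut_funK g x) (aut_path (aut_V g)).
  + by rewrite -{1}(aut_funK g x) last_map lp aut_funK.
- exists (map g p); split; first by rewrite aut_path.
  + by rewrite last_map lp.
  + by rewrite size_map.
Qed.

Lemma aut_dist g x y : dist (g x) (g y) = dist x y.
Proof. by rewrite /dist aut_walk_length. Qed.

Lemma aut_component g (S : set X) x y :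
  component_off S x y -> component_off (g @` S) (g x) (g y).
Proof.
move=> [p [pp lp Sp]]; exists (map g p); split.
- by rewrite aut_path.
- by rewrite last_map lp.
- move=> z; rewrite -map_cons => /mapP[w wp ->] [s Ss sw].
  by apply: (Sp _ wp); rewrite -(aut_funK g w) -sw aut_funK.
Qed.

Lemma aut_ray g r : ray r -> ray (g \o r).
Proof.
move=> [ri ra]; split; last by move=> n /=; rewrite aut_adj.
by apply: inj_comp => //; exact: can_inj (@aut_funK X g).
Qed.

Lemma aut_end_equiv g r s : end_equiv r s -> end_equiv (g \o r) (g \o s).
Proof.
move=> rs S fS.
have [|x [Sx [N HN] [M HM]]] := rs (aut_inv g @` S).
  exact: finite_image.
have gS : g @` (aut_inv g @` S) = S.
  by rewrite image_comp -[RHS]image_id; apply: eq_imagel => z _ /=; exact: aut_invK.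
exists (g x); split.
- by move=> Sgx; apply: Sx; exists (g x) => //; rewrite aut_funK.
- by exists N => n /HN /(aut_component g); rewrite gS.
- by exists M => n /HM /(aut_component g); rewrite gS.
Qed.

Lemma aut_geodesic g r : geodesic_ray r -> geodesic_ray (g \o r).
Proof. by move=> rg m n mn /=; rewrite aut_dist rg. Qed.

Lemma aut_hausdorff g r s :
  finite_hausdorff r s -> finite_hausdorff (g \o r) (g \o s).
Proof.
move=> [D [H1 H2]]; exists D; split=> m.
- by have [n Hn] := H1 m; exists n; rewrite /= aut_dist.
- by have [n Hn] := H2 m; exists n; rewrite /= aut_dist.
Qed.

Lemma aut_class (P : (nat -> X) -> Prop) (R : (nat -> X) -> (nat -> X) -> Prop) :
  (forall g r, P r -> P (g \o r)) ->
  (forall g r s, R r s -> R (g \o r) (g \o s)) ->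
  forall g A, is_class P R A -> is_class P R [set g \o r | r in A].
Proof.
move=> HP HR g A [r Pr ->]; exists (g \o r); first exact: HP.
apply/seteqP; split => [_ [s [Ps rs] <-]|s [Ps rs]].
  by split; [exact: HP|exact: HR].
exists (aut_V g \o s); last by apply/funext => n /=; rewrite aut_invK.
split; first exact: HP.
have := HR (aut_V g) _ _ rs; congr (R _ _).
by apply/funext => n /=; rewrite aut_funK.
Qed.

Definition ends_act g (w : ends X) : ends X :=
  exist _ _ (aut_class aut_ray aut_end_equiv g (svalP w)).

Definition boundary_act g (xi : boundary X) : boundary X :=
  exist _ _ (aut_class aut_geodesic aut_hausdorff g (svalP xi)).

End AutGroup.

Section Restrict.
Variables (X : graph) (A : set X) (g : aut X) (gA : g @` A = A).

Lemma restrict_fun_subproof (x : A) : g (val x) \in A.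
Proof. by rewrite inE -[X in X _]gA; exists (val x) => //; exact: set_valP. Qed.

Lemma restrict_inv_subproof (x : A) : aut_inv g (val x) \in A.
Proof.
have : A (val x) by exact: set_valP.
by rewrite -{1}gA => -[y Ay <-]; rewrite aut_funK inE.
Qed.

Definition restrict_fun (x : induced A) : induced A :=
  exist (fun y => y \in A) _ (restrict_fun_subproof x).
Definition restrict_inv (x : induced A) : induced A :=
  exist (fun y => y \in A) _ (restrict_inv_subproof x).

Lemma restrict_funK : cancel restrict_fun restrict_inv.
Proof. by move=> x; apply: val_inj; rewrite /= aut_funK. Qed.

Lemma restrict_invK : cancel restrict_inv restrict_fun.
Proof. by move=> x; apply: val_inj; rewrite /= aut_invK. Qed.

Lemma restrict_adj x y : adj (restrict_fun x) (restrict_fun y) = adj x y.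
Proof. exact: aut_adj. Qed.

Definition restrict_aut : aut (induced A) :=
  Aut restrict_funK restrict_invK restrict_adj.
End Restrict.

(** The automorphism of the induced subgraph on [A] given by [g], made total by
    a dummy value when [g] does not preserve [A]. *)
Definition induced_aut (X : graph) (A : set X) (g : aut X) : aut (induced A) :=
  match pselect (g @` A = A) with
  | left gA => restrict_aut gA
  | right _ => 1%g
  end.

Section TreeDecomposition.
Variables (X T : graph) (beta : T -> set X).

Definition tree_decomposition : Prop :=
  [/\ is_tree T,
      \bigcup_t beta t = setT,
      forall x y : X, adj x y -> exists t, beta t x /\ beta t y
    & forall x : X, connected_graph (induced [set t | beta t x])].

Definition adhesion (u v : T) : set X := beta u `&` beta v.

(** This is [V_u^e] for the edge [e = uv]. *)
Definition side (u v : T) : set X :=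
  \bigcup_(s in @reach (del_edge u v) u) beta s.

Definition edge_orbits (G : set (aut X)) (actT : aut X -> aut T) :
    set (set (set T)) :=
  [set [set actT g @` e | g in G] | e in @edges T].

(** [actT] is an action of [G] by tree automorphisms; its values outside [G] are
    irrelevant. *)
Definition invariant_decomposition (G : set (aut X)) (actT : aut X -> aut T) :
    Prop :=
  (forall g h, G g -> G h -> actT (g * h)%g = (actT g * actT h)%g) /\
  (forall g, G g -> forall t, beta (actT g t) = g @` beta t).

Definition stabilizer (G : set (aut X)) (actT : aut X -> aut T) (t : T) :
    set (aut X) :=
  [set g | G g /\ actT g t = t].

End TreeDecomposition.

Definition orbit_rel (gT Y : Type) (H : set gT) (act : gT -> Y -> Y)
    (y z : Y) : Prop :=
  exists2 g, H g & act g y = z.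

Definition borel_relation (Y : topologicalType) (E : Y -> Y -> Prop) : Prop :=
  <<s @open (Y * Y)%type >> [set p | E p.1 p.2].

Definition finite_borel_equivalence (Y : topologicalType) (E : Y -> Y -> Prop) :
    Prop :=
  [/\ RelationClasses.Equivalence E,
      borel_relation E
    & forall y, finite_set [set z | E y z]].

Definition borel_hyperfinite (Y : topologicalType) (E : Y -> Y -> Prop) : Prop :=
  exists F : nat -> Y -> Y -> Prop,
    [/\ forall n, finite_borel_equivalence (F n),
        forall n y z, F n y z -> F n.+1 y z
      & forall y z, E y z <-> exists n, F n y z].

Section OrbitRelations.
Variables (X T : graph) (beta : T -> set X).
Variables (G : set (aut X)) (actT : aut X -> aut T).

Definition E_boundary : boundary X -> boundary X -> Prop :=
  orbit_rel G (@boundary_act X).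

Definition E_tree : ends T -> ends T -> Prop :=
  orbit_rel G (fun g => ends_act (actT g)).

Definition E_bag (t : T) :
    boundary (induced (beta t)) -> boundary (induced (beta t)) -> Prop :=
  orbit_rel (stabilizer G actT t)
    (fun g => boundary_act (induced_aut (beta t) g)).

End OrbitRelations.

(* Main.v *)
Require Import Defs.
From mathcomp Require Import all_boot all_order all_algebra.
From mathcomp Require Import all_classical topology measurable_structure.
From mathcomp Require Import zify lra.

Set Implicit Arguments.
Unset Strict Implicit.
Unset Printing Implicit Defensive.

Import Order.TTheory GRing.Theory Num.Theory.
Local Open Scope classical_set_scope.
Local Open Scope nat_scope.

(** The adhesion sets are finite and fall into finitely many orbits, so their
    diameters are bounded, both in [X] and inside the bags.  A geodesic ray
    of [X] crosses each adhesion set only finitely often and thus picks a side of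
    every edge of [T]; these choices point either to a vertex [t] of [T] (the ray
    then stays close to the bag of [t]) or to an end of [T].  Hence the boundary of
    [X] is the disjoint union of copies of the boundaries of the bags and of a set
    of ends of [T].

    Bags are bi-Lipschitz embedded, because an excursion out of a bag can be
    replaced by a short path inside it; by the Morse lemma their boundaries embed
    topologically, with closed image.  Two rays pointing to the same end of [T]
    cross infinitely many adhesion sets of bounded diameter and are therefore
    equivalent, so the remaining points inject continuously into the ends of [T];
    under the hypothesis of (b) the adhesion sets along a ray of [T] leave every
    ball, and each end is reached.  Hyperfiniteness is then transported along this
    countable partition into pieces.

    The Morse lemma rests on the four-point condition alone: along a chain of
    [2 ^ k] steps the Gromov product with a base point drops by at most
    [k * delta]. *)

(** * The path metric *)

(** What shapes the transport is that [G] mixes the pieces: a boundary point that rests at a vertex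
    [t] is related to points resting at every vertex of the orbit of [t], whereas the hypothesis of
    (a) treats each bag by itself. So the pieces are indexed by vertices, but each one is moved by a
    chosen group element into the boundary of the bag of one representative of its orbit. The vertex
    being unique, an element of [G] relating two points of one piece must stabilize it. [T] is
    countable because [G] is and the edges form finitely many orbits; this gives an enumeration of
    the pieces, and a finite stage of the filtration joins only finitely many of them, since
    otherwise its classes could be infinite.

    The maps between the spaces are kept as relations, because the same relation is read as an
    embedding of a bag boundary in (b) and as a chart of a piece in (a). Each reading needs its own
    continuity, hence estimates that are uniform in the points: [D] is the four-point constant, [L]
    bounds paths joining points of an adhesion set inside a bag, [L.+1] is the distortion of bags,
    [K] the resulting Morse constant. *)

Lemma finite_ub (T : Type) (A : set T) (f : T -> nat) : finite_set A ->
  exists N, forall x, A x -> f x <= N.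
Proof.
move=> fA; have := finite_image f fA.
move=> /finite_seqP[s sE]; exists (\max_(n <- s) n) => x Ax.
have : (f @` A) (f x) by exists x.
by rewrite sE /= => fs; apply: (@leq_bigmax_seq _ _ xpredT id).
Qed.

Lemma finite_eventually (T : Type) (A : set T) (P : T -> nat -> Prop) :
  finite_set A -> (forall x, A x -> exists N, forall n, N <= n -> P x n) ->
  exists N, forall n, N <= n -> forall x, A x -> P x n.
Proof.
move=> fA H.
have /choice[f fP] : forall x, exists N, A x -> forall n, N <= n -> P x n.
  by move=> x; have [/H[N HN]|nA] := pselect (A x); [exists N|exists 0].
have [N HN] := finite_ub f fA.
by exists N => n Nn x Ax; apply: fP => //; apply: leq_trans Nn; exact: HN.
Qed.

Lemma crossing (P : nat -> Prop) (i j : nat) : i <= j -> P i -> ~ P j ->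
  exists k, [/\ i <= k, k < j, P k & ~ P k.+1].
Proof.
move=> ij Pi; elim: j ij => [|j IH] ij nPj.
  by move: ij; rewrite leqn0 => /eqP i0; case: nPj; rewrite -i0.
have [jlt|jge] := ltnP j i.
  have -> : j.+1 = i by lia.
  by exfalso; apply: nPj; have -> : j.+1 = i by lia.
have [Pj|nP] := pselect (P j); first by exists j; split => //; lia.
by have [k [? ? ? ?]] := IH jge nP; exists k; split => //; lia.
Qed.

Section Metric.
Variable X : graph.
Implicit Types (x y z p q : X) (s t : seq X).

Lemma dist_le_size x s : path (@adj X) x s -> dist x (last x s) <= size s.
Proof.
move=> ps; rewrite /dist; case: pselect => // h.
by case: ex_minnP => m _; apply; apply/asboolP; exists s.
Qed.

Lemma reach_geod x y : reach x y ->
  exists s, [/\ path (@adj X) x s, last x s = y & size s = dist x y].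
Proof.
move=> [s [ps ls]]; rewrite /dist; case: pselect => [h|[]]; last first.
  by exists (size s); apply/asboolP; exists s.
by case: ex_minnP => m /asboolP[u [? ? ?]] _; exists u.
Qed.

Lemma distxx x : dist x x = 0.
Proof. by apply/eqP; rewrite -leqn0 (@dist_le_size x [::]). Qed.

Lemma dist_adj_le x y : adj x y -> dist x y <= 1.
Proof. by move=> xy; apply: (@dist_le_size x [:: y]); rewrite /= xy. Qed.

Hypothesis Xc : forall x y : X, reach x y.

Lemma dist_triangle y x z : dist x z <= dist x y + dist y z.
Proof.
have [s [ps ls <-]] := reach_geod (Xc x y).
have [t [pt lt <-]] := reach_geod (Xc y z).
rewrite -size_cat; have -> : z = last x (s ++ t) by rewrite last_cat ls lt.
by apply: dist_le_size; rewrite cat_path ps ls.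
Qed.

Lemma dist_sym_le x y : dist y x <= dist x y.
Proof.
have [s [ps ls <-]] := reach_geod (Xc x y).
have -> : size s = size (rev (belast x s)) by rewrite size_rev size_belast.
have := @dist_le_size y (rev (belast x s)).
suff -> : last y (rev (belast x s)) = x.
  apply; rewrite -ls rev_path.
  by rewrite (eq_path (e' := @adj X)) // => u v; rewrite /= adj_sym.
by rewrite -ls; case: (s) => //= z u; rewrite rev_cons last_rcons.
Qed.

Lemma distC x y : dist x y = dist y x.
Proof. by apply/eqP; rewrite eqn_leq !dist_sym_le. Qed.

Lemma dist0_eq x y : dist x y = 0 -> x = y.
Proof.
move=> d0; have [s [_ ls]] := reach_geod (Xc x y).
by rewrite d0 -ls => /size0nil->.
Qed.

Lemma dist1_adj x y : dist x y = 1 -> adj x y.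
Proof.
move=> d0; have [s [ps ls]] := reach_geod (Xc x y); rewrite d0 -ls.
by case: s ps {ls} => [|z [|]] //= /andP[].
Qed.

Definition segment (g : nat -> X) (l : nat) :=
  forall i j, i <= j -> j <= l -> dist (g i) (g j) = j - i.

Lemma exists_segment x y : exists g : nat -> X,
  [/\ g 0 = x, forall i, dist x y <= i -> g i = y & segment g (dist x y)].
Proof.
have [s [ps ls zs]] := reach_geod (Xc x y).
exists (fun i => nth y (x :: s) i); split=> //.
  move=> i; rewrite -zs leq_eqVlt => /predU1P[<-|si]; last by rewrite nth_default.
  by rewrite -[X in nth _ _ X]/((size (x :: s)).-1) nth_last /= ls.
have step i j : i <= j -> j <= size s ->
    dist (nth y (x :: s) i) (nth y (x :: s) j) <= j - i.
  move=> ij; rewrite -(subnKC ij); move: (j - i) => d {ij}; rewrite addKn.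
  elim: d => [|d IH] ids; first by rewrite addn0 distxx.
  rewrite addnS in ids *; have := IH (ltnW ids).
  have := dist_adj_le (pathP y ps (i + d) ids).
  have := dist_triangle (nth y (x :: s) (i + d)) (nth y (x :: s) i)
            (nth y (x :: s) (i + d).+1).
  by rewrite /=; lia.
move=> i j ij; rewrite -zs => js.
have ls' : nth y (x :: s) (size s) = y.
  by rewrite -[X in nth _ _ X]/((size (x :: s)).-1) nth_last /= ls.
have := step 0 i (leq0n _) (leq_trans ij js).
have := step _ _ ij js.
have := step _ _ js (leqnn _).
have := dist_triangle (nth y (x :: s) i) x y.
have := dist_triangle (nth y (x :: s) j) (nth y (x :: s) i) y.
rewrite ls' -zs /=; lia.
Qed.

Lemma exists_at_dist x y n : n <= dist x y ->
  exists z, dist x z = n /\ dist x y = dist x z + dist z y.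
Proof.
move=> nd; have [g [g0 gl sg]] := exists_segment x y.
exists (g n); have := sg 0 n; have := sg n (dist x y).
rewrite (gl _ (leqnn _)) g0; lia.
Qed.

(** Gromov's inequality for products based at [p], doubled and with the terms moved across so that
    no subtraction in [nat] occurs; [D] stands for twice [delta], rounded up. *)
Definition four_point (D : nat) := forall p x y z,
  dist x z + dist p y <= maxn (dist x y + dist p z) (dist y z + dist p x) + D.

Lemma hyperbolic_four_point : gromov_hyperbolic X -> exists D, four_point D.
Proof.
move=> [d Hd]; exists (Num.bound (2%:R * d)%R) => p x y z.
have hb : (2%:R * d < (Num.bound (2%:R * d)%R)%:R :> rat)%R.
  have [d0|d0] := leP 0%R (2%:R * d)%R; first exact: archi_boundP.
  by apply: lt_le_trans d0 _; rewrite ler0n.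
have := Hd p x y z; rewrite /gromov_product minEle.
move: (Num.bound _) hb => B hb.
set a := dist p x; set b := dist p y; set c := dist p z.
set e := dist x y; set f := dist y z; set h := dist x z => H.
suff : (h + b <= e + c + B) || (h + b <= f + a + B) by lia.
rewrite -!(ler_nat rat) !natrD.
by move: H; case: ifP => _ H; apply/orP; [left|right]; lra.
Qed.

Lemma finite_ball : locally_finite X ->
  forall x n, finite_set [set y | dist x y <= n].
Proof.
move=> lf x; elim=> [|n IH].
  apply: (@sub_finite_set _ _ [set x]) => //= y /=.
  by rewrite leqn0 => /eqP/dist0_eq.
apply: (@sub_finite_set _ _
  ([set y | dist x y <= n] `|` \bigcup_(z in [set y | dist x y <= n]) [set y | adj z y])).
  move=> y /= yn; have [|yn'] := leqP (dist x y) n; first by left.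
  have [|z [zn zd]] := @exists_at_dist x y n; [exact: ltnW|right].
  by exists z => /=; [rewrite zn|apply: dist1_adj; lia].
by rewrite finite_setU; split => //; apply: bigcup_finite.
Qed.

End Metric.

(** * Konig's lemma for a sequence of sequences *)

Section Konig.
Variables (A : Type) (c : nat -> nat -> A).
Hypothesis fin : forall m, finite_set (range (fun n => c n m)).

Definition often (P : nat -> Prop) := forall N, exists2 n, N <= n & P n.

Lemma often_pigeon (P : nat -> Prop) m : often P ->
  exists v, often (fun n => P n /\ c n m = v).
Proof.
move=> oP; apply: contrapT => H.
have [N HN] : exists N, forall n, N <= n -> forall x, range (fun n => c n m) x ->
    ~ (P n /\ c n m = x).
  apply: finite_eventually => // v _; apply: contrapT => H'; apply: H.
  exists v => N; apply: contrapT => H''; apply: H'.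
  by exists N => n Nn Pn; apply: H''; exists n.
by have [n Nn Pn] := oP N; apply: (HN n Nn (c n m)).
Qed.

(** Selects infinitely many indices whose sequences share their first [m] values; each level keeps
    those that take a value occurring infinitely often at the next coordinate. *)
Fixpoint konig_prefix (m : nat) : {P : nat -> Prop | often P} :=
  if m is m'.+1 then
    let P := konig_prefix m' in
    let v := cid (often_pigeon m' (svalP P)) in
    exist often (fun n => sval P n /\ c n m' = sval v) (svalP v)
  else exist often (fun=> True) (fun N => ex_intro2 _ _ N (leqnn N) I).

Lemma konig : exists r : nat -> A,
  forall m, often (fun n => forall i, i < m -> c n i = r i).
Proof.
exists (fun m => sval (cid (often_pigeon m (svalP (konig_prefix m))))) => m N.
have [n Nn Pn] := svalP (konig_prefix m) N; exists n => //.
by elim: m Pn => // m IH [Pn cn] i; rewrite ltnS leq_eqVlt => /predU1P[->|/IH->].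
Qed.

End Konig.

(** * Geodesic rays and the boundary *)

Section Rays.
Variable X : graph.
Hypothesis Xc : forall x y : X, reach x y.
Implicit Types (x y z p q : X) (a b c : nat -> X).

Lemma finite_hausdorff_refl a : finite_hausdorff a a.
Proof. by exists 0; split=> m; exists m; rewrite distxx. Qed.

Lemma finite_hausdorff_sym a b : finite_hausdorff a b -> finite_hausdorff b a.
Proof.
move=> [C [H1 H2]]; exists C; split=> m.
  by have [n] := H2 m; exists n; rewrite distC.
by have [n] := H1 m; exists n; rewrite distC.
Qed.

Lemma finite_hausdorff_trans b a c :
  finite_hausdorff a b -> finite_hausdorff b c -> finite_hausdorff a c.
Proof.
move=> [C [H1 H2]] [D [H3 H4]]; exists (C + D); split=> m.
  have [n Hn] := H1 m; have [k Hk] := H3 n; exists k.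
  by apply: leq_trans (dist_triangle Xc (b n) _ _) _; apply: leq_add.
have [n Hn] := H4 m; have [k Hk] := H2 n; exists k.
by apply: leq_trans (dist_triangle Xc (b n) _ _) _; apply: leq_add.
Qed.

Lemma bounded_finite_hausdorff a b C :
  (forall k, dist (a k) (b k) <= C) -> finite_hausdorff a b.
Proof. by move=> H; exists C; split=> m; exists m. Qed.

(** If [a k] is within [D] of [b n], then [k] and [n] differ by at most [D + dist (a 0) (b 0)],
    because they are the distances to the two origins; sliding from [b n] to [b k] costs that much
    more. *)
Lemma finite_hausdorff_bounded a b : geodesic_ray a -> geodesic_ray b ->
  finite_hausdorff a b -> exists C, forall k, dist (a k) (b k) <= C.
Proof.
move=> ga gb [D [H _]]; exists (2 * D + dist (a 0) (b 0)) => k.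
have [n Hn] := H k.
have := ga 0 k (leq0n _); have := gb 0 n (leq0n _).
have : dist (b n) (b k) <= maxn n k - minn n k.
  have [nk|/ltnW nk] := leqP n k; first by rewrite gb.
  by rewrite distC // gb.
have := dist_triangle Xc (b n) (a k) (b k).
have := dist_triangle Xc (a k) (a 0) (b n).
have := dist_triangle Xc (a 0) (b 0) (b n).
have := dist_triangle Xc (b 0) (a 0) (a k).
have := dist_triangle Xc (b n) (b 0) (a k).
rewrite (distC Xc (b n) (a k)) (distC Xc (b 0) (a 0)); lia.
Qed.

Lemma geodesic_ray_inj a : geodesic_ray a -> injective a.
Proof.
move=> ga; have H i j : i <= j -> a i = a j -> i = j.
  by move=> ij e; have := ga _ _ ij; rewrite e distxx; lia.
move=> i j e; have [ij|/ltnW ji] := leqP i j; first exact: H.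
by apply/esym/H.
Qed.

Lemma geodesic_ray_adj a n : geodesic_ray a -> adj (a n) (a n.+1).
Proof. by move=> ga; apply: dist1_adj => //; rewrite ga // subSnn. Qed.

Hypothesis Xlf : locally_finite X.

Lemma geodesic_escape a (S : set X) : geodesic_ray a -> finite_set S ->
  exists N, forall n, N <= n -> forall x, S x -> n <= dist x (a n) + N.
Proof.
move=> ga fS; have [N HN] := finite_ub (dist (a 0)) fS.
exists N => n _ x /HN; have := ga 0 n (leq0n _).
have := dist_triangle Xc x (a 0) (a n); lia.
Qed.

(** Konig's lemma applies because the [m]-th points all lie in the finite ball of radius [m] about
    [p]. The [often] clause is kept so that estimates on long segments can be passed to the
    limit. *)
Lemma limit_ray (c : nat -> nat -> X) (l : nat -> nat) p :
  (forall n, c n 0 = p) -> (forall n, segment (c n) (l n)) ->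
  (forall n i, l n <= i -> c n i = c n (l n)) ->
  (forall M, exists N, forall n, N <= n -> M <= l n) ->
  exists r, [/\ geodesic_ray r, r 0 = p &
    forall m, often (fun n => m <= l n /\ forall i, i <= m -> c n i = r i)].
Proof.
move=> c0 sc cl lM.
have cball n m : dist p (c n m) <= m.
  rewrite -(c0 n); have [ml|/ltnW ml] := leqP m (l n); first by rewrite sc // subn0.
  by rewrite (cl n m) // sc // subn0.
have [|r Hr] := @konig X c.
  move=> m; apply: sub_finite_set (finite_ball Xc Xlf p m).
  by move=> _ [n _ <-] /=; exact: cball.
have H m : often (fun n => m <= l n /\ forall i, i <= m -> c n i = r i).
  move=> N; have [M HM] := lM m; have [n] := Hr m.+1 (maxn N M).
  rewrite geq_max => /andP[Nn Mn] cr; exists n => //; split; first exact: HM.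
  by move=> i im; apply: cr.
exists r; split=> //.
  move=> i j ij; have [n _ [jl cr]] := H j 0.
  by rewrite -!cr // sc.
by have [n _ [_ cr]] := H 0 0; rewrite -cr // c0.
Qed.

Variable D : nat.
Hypothesis hyp : four_point X D.

(** [b] is a limit of geodesics from [p] to [a n]. In the four-point inequality for [p], [b k],
    [a n], [a k] both sums on the right are at most [dist p (a n) + dist p (a 0)], which gives the
    constant. *)
Lemma rebase_ray a p : geodesic_ray a -> exists b,
  [/\ geodesic_ray b, b 0 = p & forall k, dist (a k) (b k) <= dist p (a 0) + D].
Proof.
move=> ga.
have /choice[c Hc] n := exists_segment Xc p (a n).
have la n : n <= dist p (a n) + dist p (a 0).
  have := ga 0 n (leq0n _); have := dist_triangle Xc p (a 0) (a n).
  rewrite (distC Xc (a 0) p); lia.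
have [|||| b [gb b0 H]] := @limit_ray c (fun n => dist p (a n)) p.
- by move=> n; have [] := Hc n.
- by move=> n; have [] := Hc n.
- by move=> n i li; have [_ H _] := Hc n; rewrite H // H.
- by move=> M; exists (M + dist p (a 0)) => n; have := la n; lia.
exists b; split=> // k; have [n nk [kl cb]] := H k k.
have [c0 cl sc] := Hc n.
have := hyp p (b k) (a n) (a k).
have := sc k _ kl (leqnn _); rewrite (cl _ (leqnn _)) cb //.
have := sc 0 k (leq0n _) kl; rewrite c0 cb //.
have := la n; have := dist_triangle Xc (a 0) p (a k).
have := ga 0 k (leq0n _); have := ga _ _ nk.
rewrite (distC Xc (a n) (a k)) (distC Xc (b k) (a k)); lia.
Qed.

(** [C] disappears from the bound: for [m] and [n] large enough, the alternative of the four-point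
    inequality that contains [dist (a m) (b n)] cannot be the maximum. Two applications of the
    inequality remain and cost [2 * D]. *)
Lemma fellow_travel a b C : geodesic_ray a -> geodesic_ray b ->
  (forall N, exists m n, [/\ N <= m, N <= n & dist (a m) (b n) <= C]) ->
  forall k, dist (a k) (b k) <= dist (a 0) (b 0) + 2 * D.
Proof.
move=> ga gb H k; set d := dist (a 0) (b 0).
have [m [n [Nm Nn mn]]] := H (C + 2 * k + 2 * d + 2 * D + 1).
have := hyp (a 0) (a k) (b n) (b k).
have := hyp (a 0) (a k) (a m) (b n).
have am := ga 0 m (leq0n _); have ak := ga 0 k (leq0n _).
have bn := gb 0 n (leq0n _); have bk := gb 0 k (leq0n _).
have km : k <= m by lia.
have kn : k <= n by lia.
have akm := ga k m km; have bkn := gb k n kn.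
rewrite (distC Xc (b n) (b k)).
have := dist_triangle Xc (b 0) (a 0) (b k).
have := dist_triangle Xc (a 0) (b 0) (b n).
have := dist_triangle Xc (b 0) (a 0) (b n).
rewrite (distC Xc (b 0) (a 0)) -/d.
have := dist_triangle Xc (a k) (a 0) (b n).
lia.
Qed.

Lemma hausdorff_fellow_travel a b : geodesic_ray a -> geodesic_ray b ->
  finite_hausdorff a b -> forall k, dist (a k) (b k) <= dist (a 0) (b 0) + 2 * D.
Proof.
move=> ga gb /(finite_hausdorff_bounded ga gb)[C HC]; apply: fellow_travel => //.
by move=> N; exists N, N; split => //; exact: HC.
Qed.

(** The numerical hypothesis says that the Gromov product of [a n] and [b n] at the common origin is
    at least [r], so the two rays have not yet branched at time [r]. *)
Lemma product_fellow_travel a b n r : geodesic_ray a -> geodesic_ray b ->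
  a 0 = b 0 -> 2 * r + dist (a n) (b n) <= n + n -> dist (a r) (b r) <= 2 * D.
Proof.
move=> ga gb ab H; have rn : r <= n by lia.
have := hyp (a 0) (a r) (a n) (b r).
have := hyp (a 0) (a n) (b n) (b r).
have := ga 0 r (leq0n _); have := ga 0 n (leq0n _).
have := gb 0 r (leq0n _); have := gb 0 n (leq0n _); rewrite -ab.
have := ga _ _ rn; have := gb _ _ rn.
rewrite (distC Xc (b r) (b n)); lia.
Qed.

Lemma product_ge_dist p x y g R : segment g (dist x y) -> g 0 = x ->
  g (dist x y) = y -> (forall k, k <= dist x y -> R <= dist p (g k)) ->
  2 * R + dist x y <= dist p x + dist p y + 2 * D + 2.
Proof.
move=> sg g0 gl H.
have := dist_triangle Xc x p y; have := dist_triangle Xc p x y.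
have := dist_triangle Xc y p x.
rewrite (distC Xc x p) (distC Xc y x) => t1 t2 t3.
(* The Gromov product of [p] and [y] at [x], rounded down: the time at which the geodesic passes the
   centre of the comparison tripod. The rounding accounts for the final [+ 2]. *)
set k := ((dist p x + dist x y) - dist p y)./2.
have kl : k <= dist x y by rewrite /k; lia.
have := H k kl; have := hyp p x (g k) y.
have := sg 0 k (leq0n _) kl; have := sg k _ kl (leqnn _).
rewrite g0 gl /k; lia.
Qed.

Lemma gromov_product_ge p x y r :
  (r%:R <= gromov_product p x y)%R = (2 * r + dist x y <= dist p x + dist p y).
Proof.
rewrite /gromov_product -(ler_nat rat) (natrD _ (2 * r)) (natrM _ 2) natrD.
by apply/idP/idP; lra.
Qed.

End Rays.

(** * Boundary points and their neighbourhoods *)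

Section Boundary.
Variable X : graph.
Hypothesis Xc : forall x y : X, reach x y.
Implicit Types (xi eta : boundary X) (a b : nat -> X).

Definition boundary_point a (ga : geodesic_ray a) : boundary X :=
  exist _ _ (ex_intro2 _ _ a ga erefl).

Lemma boundary_pointP a (ga : geodesic_ray a) : sval (boundary_point ga) a.
Proof. by split => //; exact: finite_hausdorff_refl. Qed.

Lemma boundary_ex xi : exists a, sval xi a.
Proof.
case: xi => A [a ga E] /=; exists a; rewrite E; split => //; exact: finite_hausdorff_refl.
Qed.

Lemma boundary_geodesic xi a : sval xi a -> geodesic_ray a.
Proof. by case: xi => A [b gb E] /=; rewrite E => -[]. Qed.

Lemma boundary_mem xi a b : sval xi a -> geodesic_ray b ->
  finite_hausdorff a b -> sval xi b.
Proof.
case: xi => A [c gc E] /=; rewrite E => -[_ ca] gb ab; split=> //.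
exact: finite_hausdorff_trans ca ab.
Qed.

Lemma boundary_hausdorff xi a b : sval xi a -> sval xi b -> finite_hausdorff a b.
Proof.
case: xi => A [c gc E] /=; rewrite E => -[_ ca] [_ cb].
by apply: finite_hausdorff_trans cb => //; exact: finite_hausdorff_sym.
Qed.

Lemma boundary_eq xi eta a b : sval xi a -> sval eta b -> finite_hausdorff a b ->
  xi = eta.
Proof.
move=> xa eb ab; apply: eq_sig_hprop => [A ? ?|]; first exact: Prop_irrelevance.
apply/seteqP; split=> c.
  move=> xc; apply: (boundary_mem eb); first exact: boundary_geodesic xc.
  apply: finite_hausdorff_trans (boundary_hausdorff xa xc) => //.
  exact: finite_hausdorff_sym.
move=> ec; apply: (boundary_mem xa); first exact: boundary_geodesic ec.
by apply: finite_hausdorff_trans (boundary_hausdorff eb ec).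
Qed.

Lemma boundary_openE (U : set (boundary X)) : open U = boundary_open U.
Proof. by []. Qed.

(** One pair of times is enough, because Gromov products do not decrease along geodesic rays issuing
    from the base point. *)
Lemma boundary_nbhs_intro p r xi eta a b m n : sval xi a -> sval eta b ->
  a 0 = p -> b 0 = p -> 2 * r + dist (a m) (b n) <= m + n ->
  boundary_nbhs p r xi eta.
Proof.
move=> xa eb ap bp H; exists a, b; split=> //; exists (maxn m n) => k.
rewrite geq_max => /andP[mk nk]; rewrite gromov_product_ge.
have ga := boundary_geodesic xa; have gb := boundary_geodesic eb.
have := ga 0 k (leq0n _); have := gb 0 k (leq0n _); rewrite ap bp.
have := ga _ _ mk; have := gb _ _ nk.
have := dist_triangle Xc (a m) (a k) (b k).
have := dist_triangle Xc (b n) (a m) (b k).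
rewrite (distC Xc (a k) (a m)); lia.
Qed.

Lemma boundary_nbhs_elim p r xi eta : boundary_nbhs p r xi eta ->
  exists a b N, [/\ sval xi a, sval eta b, a 0 = p, b 0 = p &
    forall n, N <= n -> 2 * r + dist (a n) (b n) <= n + n].
Proof.
move=> [a [b [xa eb ap bp [N HN]]]]; exists a, b, N; split=> // n /HN.
rewrite gromov_product_ge.
have := boundary_geodesic xa; have := boundary_geodesic eb.
move=> /(_ 0 n (leq0n _)) + /(_ 0 n (leq0n _)); rewrite ap bp.
by move=> -> ->; rewrite subn0.
Qed.

Hypothesis Xlf : locally_finite X.
Variable D : nat.
Hypothesis hyp : four_point X D.

Lemma boundary_ray_from xi p : exists2 a, sval xi a & a 0 = p.
Proof.
have [a xa] := boundary_ex xi; have ga := boundary_geodesic xa.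
have [b [gb bp ab]] := rebase_ray Xc Xlf hyp p ga; exists b => //.
by apply: (boundary_mem xa) => //; exact: bounded_finite_hausdorff ab.
Qed.

Lemma boundary_nbhs_rebase p q r :
  exists r', forall xi, boundary_nbhs p r' xi `<=` boundary_nbhs q r xi.
Proof.
(* Rebasing moves each of the two rays by at most [dist q p + D], so the product drops by at most
   that amount, whatever [xi] is. *)
exists (r + dist q p + D) => xi eta /boundary_nbhs_elim.
move=> [a [b [N [xa eb ap bp HN]]]].
have ga := boundary_geodesic xa; have gb := boundary_geodesic eb.
have [a' [ga' a'q aa']] := rebase_ray Xc Xlf hyp q ga.
have [b' [gb' b'q bb']] := rebase_ray Xc Xlf hyp q gb.
apply: (@boundary_nbhs_intro q r xi eta a' b' N N) => //.
- by apply: (boundary_mem xa) => //; exact: bounded_finite_hausdorff aa'.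
- by apply: (boundary_mem eb) => //; exact: bounded_finite_hausdorff bb'.
have := HN N (leqnn _); have := aa' N; have := bb' N; rewrite ap bp.
have := dist_triangle Xc (a N) (a' N) (b' N).
have := dist_triangle Xc (b N) (a N) (b' N).
rewrite (distC Xc (a' N) (a N)); lia.
Qed.

End Boundary.

(** * The Morse lemma *)

Lemma linear_le_expn A : exists K, forall k, K <= k -> A * k.+1 <= 2 ^ k.
Proof.
exists (4 * A) => k Ak.
(* Squaring this linear bound makes [2 ^ k] at least quadratic in [k]. *)
have hk : (k./2).+1 <= 2 ^ k./2 by exact: ltn_expl.
have -> : 2 ^ k = 2 ^ odd k * (2 ^ k./2 * 2 ^ k./2).
  by rewrite -!expnD; congr (2 ^ _); have := odd_double_half k; lia.
have h2 : (k./2).+1 * (k./2).+1 <= 2 ^ k./2 * 2 ^ k./2 by exact: leq_mul.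
apply: leq_trans (leq_pmull _ _); last by rewrite expn_gt0.
apply: leq_trans h2.
have : k.+1 <= (k./2).+1 * 2 by lia.
move=> /(leq_mul (leqnn A))/leq_trans; apply.
rewrite mulnCA; apply: leq_mul => //; lia.
Qed.

(** [6 * L * R + 2] bounds the number of steps of a detour around a ball of radius [R], and [k * D]
    is the loss of the doubled product along [2 ^ k] steps. The loss is only logarithmic in [R],
    hence below [2 * R - 1] for large [R]. *)
Lemma log_le_linear L D : exists K, forall R, K < R ->
  exists k, 6 * L * R + 2 <= 2 ^ k /\ k * D < 2 * R - 1.
Proof.
have [k0 Hk0] := linear_le_expn (3 * L * D.+1 + 6 * L + 2).
(* The largest [k] whose loss, counted with [D.+1] to avoid dividing by zero, still fits below
   [2 * R - 1]. *)
exists (k0.+1 * D.+1) => R RK; exists ((2 * R - 2) %/ D.+1).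
set k := _ %/ _.
have k1 : k * D.+1 <= 2 * R - 2 by exact: leq_divM.
have k2 : 2 * R - 2 < k.+1 * D.+1 by exact: ltn_ceil.
split; last first.
  have : k * D <= k * D.+1 by rewrite leq_mul2l leqnSn orbT.
  by lia.
have kk : k0 <= k.
  by rewrite /k leq_divRL //; move: RK; rewrite mulSn; move: (k0 * _) => m; lia.
apply: leq_trans (Hk0 k kk).
have R2 : 2 * R <= k.+1 * D.+1 + 2 by lia.
have := leq_mul (leqnn (3 * L)) R2.
have -> : 3 * L * (2 * R) = 6 * L * R by lia.
have -> : 3 * L * (k.+1 * D.+1 + 2) = 3 * L * D.+1 * k.+1 + 6 * L by lia.
rewrite !mulnDl !mulnS; move: (3 * L * D.+1 * k) (6 * L * R) (6 * L * k); lia.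
Qed.

Section Morse.
Variable X : graph.
Hypothesis Xc : forall x y : X, reach x y.
Variable D : nat.
Hypothesis hyp : four_point X D.
Implicit Types (p x y z : X) (f c g : nat -> X).

Lemma product_chain p f m k a n : 0 < n -> n <= 2 ^ k ->
  (forall i, a <= i -> i < a + n ->
    m + dist (f i) (f i.+1) <= dist p (f i) + dist p (f i.+1)) ->
  m + dist (f a) (f (a + n)) <= dist p (f a) + dist p (f (a + n)) + k * D.
Proof.
elim: k a n => [|k IH] a n n0 nk H.
  have -> : n = 1 by move: nk; rewrite expn0; lia.
  by rewrite mul0n addn0 addn1; apply: H; lia.
have [n1|n1] := leqP n 1.
  have -> : n = 1 by lia.
  by rewrite addn1; apply: leq_trans (leq_addr _ _); apply: H; lia.
have H1 := IH a n./2; have H2 := IH (a + n./2) (n - n./2).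
have n2' : a + n./2 + (n - n./2) = a + n by lia.
move: H1 H2; rewrite n2' => H1 H2.
have e2 : 2 ^ k.+1 = 2 ^ k + 2 ^ k by rewrite expnS; lia.
have {}H1 := H1 ltac:(lia) ltac:(lia) (fun i h1 h2 => H i h1 ltac:(lia)).
have {}H2 := H2 ltac:(lia) ltac:(lia) (fun i h1 h2 => H i ltac:(lia) ltac:(lia)).
have := hyp p (f a) (f (a + n./2)) (f (a + n)).
rewrite mulSn; move: (k * D) H1 H2; lia.
Qed.

Definition quasi_geodesic L c n := forall i j, i <= j -> j <= n ->
  dist (c i) (c j) <= j - i /\ j - i <= L * dist (c i) (c j).

(* The chain [y], [c i], ..., [c j], [z] stays at distance at least [R] from
   [p], so its length is exponential in [R]; but [L] bounds it linearly. *)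
Lemma detour_bound L c n R k p y z i j : quasi_geodesic L c n ->
  0 < R -> i <= j -> j <= n -> (forall s, s <= n -> R <= dist p (c s)) ->
  2 * R + dist y (c i) <= dist p y + dist p (c i) -> dist y (c i) <= R ->
  2 * R + dist z (c j) <= dist p z + dist p (c j) -> dist z (c j) <= R ->
  dist y z <= 4 * R -> 6 * L * R + 2 <= 2 ^ k ->
  2 * R - 1 + dist y z <= dist p y + dist p z + k * D.
Proof.
move=> qc R0 ij jn HR y1 y2 z1 z2 yz Lk.
pose f s := if s == 0 then y else if s <= (j - i).+1 then c (i + s.-1) else z.
have := @product_chain p f (2 * R - 1) k 0 (j - i).+2 isT.
have -> : f 0 = y by [].
have -> : f (0 + (j - i).+2) = z.
  by rewrite /f add0n /= ifF //; apply/negbTE; rewrite -ltnNge.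
apply.
  (* [c i] and [c j] are at distance at most [R + 4 * R + R], so [j - i] is at most [6 * L * R]; the
     two outer links make the chain have at most [6 * L * R + 2] steps. *)
  have := dist_triangle Xc (c i) y (c j); have := dist_triangle Xc (c i) z (c j).
  have := dist_triangle Xc y (c i) (c j); have := dist_triangle Xc z y (c j).
  have [_] := qc _ _ ij jn; rewrite (distC Xc (c i) y).
  move: (dist (c i) (c j)) => d h1 h2 h3 h4 h5.
  have : L * d <= L * (6 * R) by apply: leq_mul => //; lia.
  by move: h1 Lk; nia.
move=> s _; rewrite add0n => sn; rewrite /f /=.
have [->|s0] := eqVneq s 0.
  by rewrite ltn0Sn addn0; lia.
(* Consecutive points of [c] are at distance at most one while both are at least [R] away from [p]:
   this is the origin of the [- 1] in [2 * R - 1]. *)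
have [sji|sji] := leqP s (j - i).
  have s1 : 0 < s by rewrite lt0n.
  rewrite !ifT; [|by lia..].
  have [h _] := qc (i + s.-1) (i + s) ltac:(lia) ltac:(lia).
  have := HR (i + s.-1) ltac:(lia); have := HR (i + s) ltac:(lia); lia.
have -> : s = (j - i).+1 by lia.
by rewrite leqnn ltnn /= subnKC // (distC Xc (c j) z); lia.
Qed.

(** If [p := g s] had no point of [c] within [R - 1], then [c] would avoid a ball about [p]. The
    points [y] and [z] of [g] at distance [2 * R] on either side of [p] have Gromov product zero at
    [p], but the detour from [y] to [z] along [c] makes it positive. *)
Lemma morse_descent L c n g l R k : quasi_geodesic L c n -> segment g l ->
  g 0 = c 0 -> g l = c n -> 6 * L * R + 2 <= 2 ^ k -> k * D < 2 * R - 1 ->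
  (forall s, s <= l -> exists2 i, i <= n & dist (g s) (c i) <= R) ->
  forall s, s <= l -> exists2 i, i <= n & dist (g s) (c i) <= R.-1.
Proof.
move=> qc sg g0 gl Rk kD H s sl; apply: contrapT => nH.
set p := g s; have R0 : 0 < R by lia.
have HR i : i <= n -> R <= dist p (c i).
  move=> iln; rewrite leqNgt; apply/negP => h; apply: nH; exists i => //.
  by rewrite -/p; lia.
(* Truncated subtraction, and [minn] for [z], clip these points at the ends of [g], which lie on [c]
   themselves. *)
pose y := g (s - 2 * R).
pose z := g (minn l (s + 2 * R)).
have [i iln [y1 y2]] : exists2 i, i <= n &
   2 * R + dist y (c i) <= dist p y + dist p (c i) /\ dist y (c i) <= R.
  have [sR|Rs] := leqP s (2 * R).
    exists 0 => //; have := HR 0 isT.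
    rewrite /y; have -> : s - 2 * R = 0 by lia.
    by rewrite g0 distxx; lia.
  have [i iln yi] := H (s - 2 * R) ltac:(lia); exists i => //.
  have := sg (s - 2 * R) s ltac:(lia) sl; have := HR i iln.
  by rewrite -/p -/y in yi *; rewrite (distC Xc p y); lia.
have [j jn [z1 z2]] : exists2 j, j <= n &
   2 * R + dist z (c j) <= dist p z + dist p (c j) /\ dist z (c j) <= R.
  have [sR|Rs] := leqP l (s + 2 * R).
    exists n => //; have := HR n (leqnn n).
    rewrite /z; have -> : minn l (s + 2 * R) = l by lia.
    by rewrite gl distxx; lia.
  have [j jn zj] := H (s + 2 * R) ltac:(lia); exists j => //.
  have := sg s (s + 2 * R) ltac:(lia) ltac:(lia); have := HR j jn.
  rewrite -/p /z; have -> : minn l (s + 2 * R) = s + 2 * R by lia.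
  by lia.
have yz : dist y z = dist p y + dist p z /\ dist y z <= 4 * R.
  rewrite (distC Xc p y) /y /z !sg; lia.
(* The points of [c] near [y] and [z] may occur in either order; in the second case the chain is
   read from [z] to [y]. *)
have [ij|/ltnW ji] := leqP i j.
  have := detour_bound qc R0 ij jn HR y1 y2 z1 z2 yz.2 Rk.
  by lia.
have zy : dist z y <= 4 * R by rewrite distC //; lia.
have := detour_bound qc R0 ji iln HR z1 z2 y1 y2 zy Rk.
by rewrite (distC Xc z y); lia.
Qed.

(** Every point of [g] is within [l] of [g 0 = c 0]. From this trivial bound the radius descends one
    unit at a time until the logarithmic estimate fails, at a [K] that does not depend on the
    curves. *)
Lemma morse_segment L : exists K, forall c n g l,
  quasi_geodesic L c n -> segment g l -> g 0 = c 0 -> g l = c n ->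
  forall s, s <= l -> exists2 i, i <= n & dist (g s) (c i) <= K.
Proof.
have [K HK] := log_le_linear L D; exists K => c n g l qc sg g0 gl.
have H R : (forall s, s <= l -> exists2 i, i <= n & dist (g s) (c i) <= R + K) ->
    forall s, s <= l -> exists2 i, i <= n & dist (g s) (c i) <= K.
  elim: R => [|R IH] //; rewrite addSn => H; apply: IH.
  have [k [Rk kD]] := HK (R + K).+1 ltac:(lia).
  exact: morse_descent qc sg g0 gl Rk kD H.
apply: (H l) => s sl; exists 0 => //.
by rewrite -g0 distC // sg //; lia.
Qed.

(** For the second half, follow [g] until its nearby points of [c] stop having index at most [i].
    There two consecutive points of [g] are near some [c j] and [c j'] with [j <= i <= j']; these
    are within [2 * K + 1] of each other, so [j' - j] is at most [L * (2 * K + 1)]. *)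
Lemma morse_quasi L : exists K, forall c n g l,
  quasi_geodesic L c n -> segment g l -> g 0 = c 0 -> g l = c n ->
  (forall s, s <= l -> exists2 i, i <= n & dist (g s) (c i) <= K) /\
  (forall i, i <= n -> exists2 s, s <= l & dist (g s) (c i) <= K).
Proof.
have [K HK] := morse_segment L; exists (L * (2 * K + 1) + K) => c n g l qc sg g0 gl.
have {}HK := HK c n g l qc sg g0 gl.
split=> [s sl|i iln].
  by have [i iln Hi] := HK s sl; exists i => //; exact: leq_trans Hi (leq_addl _ _).
have near s j j' : s <= l -> j <= i -> i <= j' -> j' <= n ->
    dist (g s) (c j) <= K -> dist (g s) (c j') <= K + 1 ->
    dist (g s) (c i) <= L * (2 * K + 1) + K.
  move=> sl ji ij jn h1 h2.
  have [h3 _] := qc j i ji iln; have [_] := qc j j' ltac:(lia) jn.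
  have := dist_triangle Xc (g s) (c j) (c j').
  have := dist_triangle Xc (c j) (g s) (c i).
  rewrite (distC Xc (c j) (g s)) => h4 h5.
  have : L * dist (c j) (c j') <= L * (2 * K + 1) by apply: leq_mul => //; lia.
  move: (L * (2 * K + 1)) (L * dist (c j) (c j')) h4 h3; lia.
pose P s := exists2 j, j <= i & dist (g s) (c j) <= K.
have [Pl|nPl] := pselect (P l).
  have [j ji jK] := Pl; exists l => //.
  by apply: (near l j n) => //; rewrite gl distxx.
have P0 : P 0 by exists 0 => //; rewrite g0 distxx.
have [s [_ sl [j ji jK] nP]] := crossing (leq0n l) P0 nPl.
have [j' jn jK'] := HK s.+1 sl.
have ij : i <= j'.
  by rewrite leqNgt; apply/negP => /ltnW h; apply: nP; exists j'.
exists s; first exact: ltnW.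
apply: (near s j j') => //; first exact: ltnW.
have := dist_triangle Xc (g s.+1) (g s) (c j').
by rewrite sg // subSnn; lia.
Qed.

End Morse.

(** * Trees and their ends *)

Section Components.
Variable X : graph.
Implicit Types (S : set X) (x y z : X).

Lemma component_off_refl S x : ~ S x -> component_off S x x.
Proof. by move=> Sx; exists [::]; split=> // z; rewrite inE => /eqP->. Qed.

Lemma component_off_notin S x y : component_off S x y -> ~ S y.
Proof. by move=> [p [_ <- H]]; apply: H; exact: mem_last. Qed.

Lemma component_off_trans S y x z :
  component_off S x y -> component_off S y z -> component_off S x z.
Proof.
move=> [p [pp lp Sp]] [q [pq lq Sq]]; exists (p ++ q); split.
- by rewrite cat_path pp lp.
- by rewrite last_cat lp.
- move=> w; rewrite -cat_cons mem_cat => /orP[/Sp//|wq].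
  by apply: Sq; rewrite inE wq orbT.
Qed.

Lemma component_off_edge S x y : ~ S x -> ~ S y -> adj x y -> component_off S x y.
Proof.
move=> Sx Sy xy; exists [:: y]; split; rewrite /= ?xy // => z.
by rewrite !inE => /orP[]/eqP->.
Qed.

Lemma component_off_step S x y z :
  component_off S x y -> adj y z -> ~ S z -> component_off S x z.
Proof.
move=> xy yz Sz; apply: (component_off_trans xy).
exact: component_off_edge (component_off_notin xy) Sz yz.
Qed.

Lemma component_off_ind S x (P : X -> Prop) : P x ->
  (forall y z, component_off S x y -> P y -> adj y z -> ~ S z -> P z) ->
  forall y, component_off S x y -> P y.
Proof.
move=> Px step y [p [pp lp Sp]].
suff : component_off S x (last x p) /\ P (last x p) by rewrite lp => -[].
elim/last_ind: p pp Sp {lp} => [|p z IH].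
  by move=> _ H; split => //; apply: component_off_refl; apply: H; rewrite inE.
rewrite rcons_path last_rcons => /andP[pp yz] H.
have [|xy Py] := IH pp.
  by move=> w wp; apply: H; rewrite -rcons_cons mem_rcons inE wp orbT.
have Sz : ~ S z by apply: H; rewrite -rcons_cons mem_rcons inE eqxx.
by split; [exact: component_off_step xy yz Sz|exact: step yz Sz].
Qed.

Lemma component_off_sym S x y : component_off S x y -> component_off S y x.
Proof.
move=> xy; have [p [_ _ Sp]] := xy.
have Sx : ~ S x by apply: Sp; rewrite inE eqxx.
move: y {p Sp} xy; apply: component_off_ind; first exact: component_off_refl.
move=> y z xy yx yz Sz; apply: component_off_trans yx.
by apply: component_off_edge => //; [exact: component_off_notin xy|rewrite adj_sym].
Qed.

Lemma component_off_sub S S' x x' : component_off S' x' x ->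
  (forall z, component_off S x z -> ~ S' z) ->
  component_off S x `<=` component_off S' x'.
Proof.
move=> x'x H; apply: component_off_ind => // y z xy x'y yz Sz.
apply: (component_off_step x'y) => //; apply: H.
exact: component_off_step xy yz Sz.
Qed.

Lemma component_off_subset S S' x : S' `<=` S ->
  component_off S x `<=` component_off S' x.
Proof. by move=> SS y [p [pp lp Sp]]; exists p; split=> // z /Sp + /SS. Qed.

Lemma reach_ind x (P : X -> Prop) : P x ->
  (forall y z, P y -> adj y z -> P z) -> forall y, reach x y -> P y.
Proof.
move=> Px step y [p [pp <-]].
elim/last_ind: p pp => [//|p z IH]; rewrite rcons_path last_rcons.
by move=> /andP[/IH Py yz]; exact: step yz.
Qed.

End Components.

Lemma inj_escape (T : Type) (r : nat -> T) (S : set T) : injective r ->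
  finite_set S -> exists N, forall n, N <= n -> ~ S (r n).
Proof.
move=> ri fS; have [|N HN] := @finite_eventually _ S (fun x n => r n <> x) fS.
  move=> x _; have [[m <-]|H] := pselect (exists m, r m = x).
    by exists m.+1 => n mn /ri; lia.
  by exists 0 => n _ rx; apply: H; exists n.
by exists N => n Nn Sr; apply: (HN n Nn (r n)).
Qed.

Lemma has_tail_in_sub (X : graph) (r : nat -> X) (A B : set X) :
  A `<=` B -> has_tail_in r A -> has_tail_in r B.
Proof. by move=> AB [N HN]; exists N => n /HN/AB. Qed.

Lemma has_tail_in_meet (X : graph) (r : nat -> X) (A B : set X) :
  has_tail_in r A -> has_tail_in r B ->
  exists N, forall n, N <= n -> A (r n) /\ B (r n).
Proof.
move=> [N HN] [M HM]; exists (maxn N M) => n; rewrite geq_max => /andP[h1 h2].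
by split; [exact: HN|exact: HM].
Qed.

Lemma end_equiv_refl (X : graph) (r : nat -> X) : ray r -> end_equiv r r.
Proof.
move=> [ri ra] S fS; have [N HN] := inj_escape ri fS.
have H : has_tail_in r (component_off S (r N)).
  exists N => n Nn; rewrite -(subnKC Nn); elim: (n - N) => [|d IH].
    by rewrite addn0; apply/component_off_refl/HN.
  rewrite addnS; apply: (component_off_step IH) => //; apply: HN; lia.
by exists (r N); split => //; exact: HN.
Qed.

Section Tree.
Variable T : graph.
Hypothesis Ttree : is_tree T.
Implicit Types (u v s t : T) (r : nat -> T) (w : ends T).

Let Tc : forall s t, reach s t. Proof. by case: Ttree => -[]. Qed.

(* The component of [T - uv] containing [u]; deleting the vertex [v] instead of
   the edge [uv] gives the same set. *)
Definition branch u v : set T := component_off [set v] u.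

Lemma adj_neq u v : adj u v -> u <> v.
Proof. by move=> uv e; move: uv; rewrite e adj_irr. Qed.

Lemma branch_self u v : adj u v -> branch u v u.
Proof. by move=> /adj_neq uv; exact: component_off_refl. Qed.

Lemma branch_exit u v s t : adj u v -> branch u v s -> adj s t -> ~ branch u v t ->
  s = u /\ t = v.
Proof.
move=> uv us st ut.
have tv : t = v by apply: contrapT => tv; apply: ut; exact: component_off_step us st tv.
split=> //; subst t.
have [p [pp lp vp]] := us.
move: lp; case/shortenP: pp => q pq uq sub lp.
(* A simple path from [u] to [s] that avoids [v] closes up through [v]; acyclicity leaves only the
   path of length zero, that is [s = u]. *)
have /Ttree.2 : ucycle (@adj T) [:: v, u & q].
  rewrite /ucycle /= rcons_path lp pq (adj_sym v u) uv st /=.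
  move: uq => /= /andP[-> ->]; rewrite !andbT.
  apply/negP => vq.
  move: vq; rewrite inE => /orP[/eqP vu|/sub vp'].
    by apply: (vp v) => //; rewrite vu inE eqxx.
  by apply: (vp v) => //; rewrite inE vp' orbT.
by rewrite -lp; case: q {pq uq sub lp}.
Qed.

Lemma branch_disjoint u v s : adj u v -> branch u v s -> branch v u s -> False.
Proof.
move=> uv us vs; move: us; move: s vs; apply: component_off_ind.
  by move=> /component_off_notin; apply.
move=> y z vy nuy yz zu uz; apply: nuy; apply: contrapT => nuy.
have [zu' _] := branch_exit uv uz (etrans (adj_sym _ _) yz) nuy.
by apply: zu.
Qed.

Lemma branch_cover u v s : adj u v -> branch u v s \/ branch v u s.
Proof.
move=> uv; have vu : adj v u by rewrite adj_sym.
move: s (Tc u s); apply: reach_ind; first by left; exact: branch_self.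
move=> y z [uy|vy] yz.
  have [uz|nuz] := pselect (branch u v z); [by left|right].
  by have [_ ->] := branch_exit uv uy yz nuz; exact: branch_self.
have [vz|nvz] := pselect (branch v u z); [by right|left].
by have [_ ->] := branch_exit vu vy yz nvz; exact: branch_self.
Qed.

Lemma reach_del_edge u v : adj u v -> @reach (del_edge u v) u = branch u v.
Proof.
move=> uv; apply/seteqP; split.
  apply: (@reach_ind (del_edge u v)); first exact: branch_self.
  move=> y z uy /= /andP[yz nuv]; apply: contrapT => nuz.
  have [yu zv] := branch_exit uv uy yz nuz.
  by move: nuv; rewrite yu zv !eqxx.
apply: (@component_off_ind _ [set v] u (@reach (del_edge u v) u)); first by exists [::].
move=> y z uy [p [pp lp]] yz zv; exists (rcons p z); rewrite rcons_path last_rcons.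
split=> //; rewrite pp /= lp /del_adj yz /= negb_or !negb_and.
apply/andP; split; apply/orP; first by right; apply/eqP.
by left; apply/eqP => yv; apply: (component_off_notin uy).
Qed.

Lemma toward_neighbour t v : t <> v -> exists2 s, adj t s & branch s t v.
Proof.
move=> tv; have [p [pp lp]] := Tc t v.
case/shortenP: pp lp => q pq uq _ lq.
case: q pq uq lq => [|s q] /=; first by move=> _ _ /tv.
move=> /andP[ts pq] /andP[tq _] lq; exists s => //; exists q; split=> //.
by move=> z zq zt; move: tq; rewrite -zt zq.
Qed.

Lemma separating_edge s t : s <> t -> exists u v, [/\ adj u v, branch u v s & branch v u t].
Proof.
move=> st; have [v sv vt] := toward_neighbour st; exists s, v; split=> //.
exact: branch_self.
Qed.

Lemma ray_tail_branch r u v : ray r -> adj u v ->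
  has_tail_in r (branch u v) \/ has_tail_in r (branch v u).
Proof.
move=> [ri ra] uv; have vu : adj v u by rewrite adj_sym.
have [|N HN] := inj_escape ri (S := [set u; v]).
  by rewrite finite_setU; split; exact: finite_set1.
have stay x y : adj x y -> (forall n, N <= n -> r n <> y) ->
    branch x y (r N) -> has_tail_in r (branch x y).
  move=> xy ny xN; exists N => n Nn; rewrite -(subnKC Nn).
  elim: (n - N) => [|d IH]; first by rewrite addn0.
  by rewrite addnS; apply: (component_off_step IH) => //=; apply: ny; lia.
have [uN|vN] := branch_cover (r N) uv; [left|right]; apply: stay => // n /HN H e.
  by apply: H; right.
by apply: H; left.
Qed.

Lemma ray_tail_excl r u v : adj u v ->
  has_tail_in r (branch u v) -> has_tail_in r (branch v u) -> False.
Proof.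
move=> uv h1 h2; have [N HN] := has_tail_in_meet h1 h2.
by have [h3 h4] := HN N (leqnn _); exact: branch_disjoint h3 h4.
Qed.

(** Once the ray has left a fixed path from [r 0] to [s] for good, walking back along the ray and
    then along that path joins [r n] to [s] without meeting [r n.+1]. *)
Lemma ray_behind r s : ray r ->
  exists N, forall n, N <= n -> branch (r n) (r n.+1) s.
Proof.
move=> [ri ra]; have [p [pp lp]] := Tc (r 0) s.
have [|N HN] := inj_escape ri (S := [set` r 0 :: p]); first exact: finite_seq.
exists N => n Nn.
have step i : i <= n -> branch (r n) (r n.+1) (r (n - i)).
  elim: i => [|i IH] iln; first by rewrite subn0; apply: branch_self; exact: ra.
  apply: (component_off_step (IH (ltnW iln))).
    by rewrite adj_sym; have -> : n - i = (n - i.+1).+1 by lia.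
  by move=> /= /ri; lia.
have := step n (leqnn n); rewrite subnn => h.
apply: (component_off_trans h); exists p; split=> // z zp /= zr.
by apply: (HN n.+1 (leqW Nn)); rewrite -zr.
Qed.

Lemma ray_ahead r n : ray r -> has_tail_in r (branch (r n.+1) (r n)).
Proof.
move=> [ri ra]; exists n.+1 => m nm; rewrite -(subnKC nm).
elim: (m - n.+1) => [|d IH].
  by rewrite addn0; apply: branch_self; rewrite adj_sym; exact: ra.
by rewrite addnS; apply: (component_off_step IH) => //= /ri; lia.
Qed.

(** An end of a tree amounts to a choice of a side for every edge. In the converse direction a
    finite set [S] lies behind a late edge of [r], so the branch ahead of that edge sits in one
    component of the complement. *)
Lemma end_equivP r r' : ray r -> ray r' ->
  end_equiv r r' <->
  (forall u v, adj u v -> has_tail_in r (branch u v) -> has_tail_in r' (branch u v)).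
Proof.
move=> rr rr'; split=> H.
  move=> u v uv tr; have [|x [Sx xr [M xr']]] := H [set u; v].
    by rewrite finite_setU; split; exact: finite_set1.
  have sub : component_off [set u; v] x `<=` component_off [set v] x.
    by apply: component_off_subset => z ->; right.
  have [N HN] := has_tail_in_meet tr xr.
  have [h1 /sub h2] := HN N (leqnn N).
  exists M => n /xr'/sub h3; apply: (component_off_trans h1).
  exact: component_off_trans (component_off_sym h2) h3.
move=> S fS.
have [N HN] : exists N, forall n, N <= n -> forall s, S s -> branch (r n) (r n.+1) s.
  by apply: finite_eventually => // s _; exact: ray_behind.
have aN : adj (r N.+1) (r N) by rewrite adj_sym; exact: rr.2.
have sub : branch (r N.+1) (r N) `<=` component_off S (r N.+1).
  apply: component_off_sub.
    apply: component_off_refl => /(HN _ (leqnn N)) h.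
    by apply: (branch_disjoint aN) h; exact: branch_self.
  by move=> z h /(HN _ (leqnn N)); exact: branch_disjoint h.
exists (r N.+1); split.
- by move=> /(HN _ (leqnn N)); apply: (branch_disjoint aN); exact: branch_self.
- exact: has_tail_in_sub sub (ray_ahead _ rr).
- by apply: has_tail_in_sub sub _; apply: H aN _; exact: ray_ahead.
Qed.

Lemma ends_ex w : exists r, sval w r.
Proof.
by case: w => A [r rr E] /=; exists r; rewrite E; split=> //; exact: end_equiv_refl.
Qed.

Lemma ends_ray w r : sval w r -> ray r.
Proof. by case: w => A [s rs E] /=; rewrite E => -[]. Qed.

Lemma end_tailsP w r u v : sval w r -> adj u v ->
  end_tails_in w (branch u v) <-> has_tail_in r (branch u v).
Proof.
move=> wr uv; split; first exact.
have vu : adj v u by rewrite adj_sym.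
move=> tr r' wr'; case: w wr wr' => A [s rs E] /=; rewrite E.
move=> [rr sr] [rr' sr'].
have {}sr := (end_equivP rs rr).1 sr.
apply: (end_equivP rs rr').1 => //.
have [//|/(sr _ _ vu)] := ray_tail_branch rs uv.
by move=> /(ray_tail_excl uv tr).
Qed.

Lemma end_tails_or w u v : adj u v ->
  end_tails_in w (branch u v) \/ end_tails_in w (branch v u).
Proof.
move=> uv; have [r wr] := ends_ex w; have vu : adj v u by rewrite adj_sym.
by have [h|h] := ray_tail_branch (ends_ray wr) uv; [left|right]; apply/(end_tailsP wr).
Qed.

Lemma end_tails_excl w u v : adj u v ->
  end_tails_in w (branch u v) -> end_tails_in w (branch v u) -> False.
Proof.
move=> uv h1 h2; have [r wr] := ends_ex w.
exact: ray_tail_excl uv (h1 _ wr) (h2 _ wr).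
Qed.

Definition end_point r (rr : ray r) : ends T :=
  exist _ _ (ex_intro2 _ _ r rr erefl).

Lemma end_pointP r (rr : ray r) : sval (end_point rr) r.
Proof. by split => //; exact: end_equiv_refl. Qed.

Lemma ends_eq w w' :
  (forall u v, adj u v -> end_tails_in w (branch u v) -> end_tails_in w' (branch u v)) ->
  w = w'.
Proof.
move=> H; have [r wr] := ends_ex w; have [r' wr'] := ends_ex w'.
have rr := ends_ray wr; have rr' := ends_ray wr'.
have H' u v : adj u v -> end_tails_in w' (branch u v) -> end_tails_in w (branch u v).
  move=> uv h; have [//|h'] := end_tails_or w uv.
  have vu : adj v u by rewrite adj_sym.
  by case: (end_tails_excl uv h (H _ _ vu h')).
have mem w1 (s s' : nat -> T) : sval w1 s -> ray s' -> (forall u v, adj u v ->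
    has_tail_in s (branch u v) -> has_tail_in s' (branch u v)) -> sval w1 s'.
  case: w1 => A [q rq E] /=; rewrite E => -[rs qs] rs' h; split=> //.
  apply/end_equivP => // u v uv /((end_equivP rq rs).1 qs _ _ uv); exact: h.
apply: eq_sig_hprop => [A ? ?|]; first exact: Prop_irrelevance.
apply/seteqP; split=> s ws.
  apply: (mem w' r') => //; first exact: ends_ray ws.
  move=> u v uv /(end_tailsP wr' uv)/(H' _ _ uv); exact.
apply: (mem w r) => //; first exact: ends_ray ws.
move=> u v uv /(end_tailsP wr uv)/(H _ _ uv); exact.
Qed.

Lemma ends_open_branch u v : adj u v -> open [set w | end_tails_in w (branch u v)].
Proof.
move=> uv; set B := [set w | _].
have bB : end_basic B.
  by exists [set v], u; split; [exact: finite_set1|exact: adj_neq|by []].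
exists [set B]; last by rewrite bigcup_set1.
move=> _ ->; exists (fset_set [set B]).
  by move=> i; rewrite in_fset_set ?inE; [move=> ->|exact: finite_set1].
by rewrite fset_setK ?bigcap_set1 //; exact: finite_set1.
Qed.

(** The branches ahead of a ray form a neighbourhood basis of its end: each of the finitely many
    finite sets that define a basic neighbourhood is eventually behind the ray. *)
Lemma ends_open_nbhs (O : set (ends T)) w r : open O -> O w -> sval w r ->
  exists N, forall n, N <= n -> forall w',
    end_tails_in w' (branch (r n.+1) (r n)) -> O w'.
Proof.
move=> [D sD <-] [B DB] wB wr; have rr := ends_ray wr.
have [E [fE sE EB]] : exists E : set (set (ends T)),
    [/\ finite_set E, E `<=` @end_basic T & \bigcap_(A in E) A = B].
  have [E sE <-] := sD _ DB; eexists; split; last reflexivity.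
    exact: finite_fset.
  by move=> A EA; have := sE A EA; rewrite inE.
suff [N HN] : exists N, forall n, N <= n -> forall A : set (ends T), E A -> forall w',
    end_tails_in w' (branch (r n.+1) (r n)) -> A w'.
  exists N => n Nn w' h; exists B => //; rewrite -EB.
  suff: (\bigcap_(A in E) A) w' by [].
  by move=> A EA; exact: HN h.
apply: finite_eventually => // A EA.
have Aw : A w by move: wB; rewrite -EB; apply.
have [S [x [fS Sx AE]]] := sE A EA.
move: Aw; rewrite AE => /(_ _ wr)[M HM].
have [N HN] : exists N, forall n, N <= n -> forall s, S s -> branch (r n) (r n.+1) s.
  by apply: finite_eventually => // s _; exact: ray_behind.
exists (maxn N M) => n; rewrite geq_max => /andP[Nn Mn] w' h r' wr'.
have an : adj (r n.+1) (r n) by rewrite adj_sym; exact: rr.2.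
apply: has_tail_in_sub (h r' wr'); apply: component_off_sub.
  exact: HM (leqW Mn).
by move=> z zh /(HN _ Nn); exact: branch_disjoint zh.
Qed.

(** The branches ahead of the walk are nested, so a vertex that has been left behind cannot
    recur. *)
Lemma nonbacktracking_ray r : (forall n, adj (r n) (r n.+1)) ->
  (forall n, r n.+2 <> r n) -> ray r.
Proof.
move=> ra rb; split=> //.
have step n : branch (r n.+2) (r n.+1) `<=` branch (r n.+1) (r n).
  have an : adj (r n.+1) (r n.+2) by [].
  apply: component_off_sub.
    apply: component_off_edge; [|exact: rb|exact: ra].
    by apply: adj_neq; rewrite adj_sym.
  move=> z zh /= zr; apply: (branch_disjoint an) zh; rewrite zr.
  apply: component_off_edge; [exact: adj_neq|by move=> e; exact: rb (esym e)|].
  by rewrite adj_sym.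
have nest n d : branch (r (n + d).+1) (r (n + d)) `<=` branch (r n.+1) (r n).
  elim: d => [|d IH]; first by rewrite addn0.
  by rewrite addnS; apply: subset_trans (step _) IH.
have lt_neq m n : m < n -> r m <> r n.
  move=> mn e; have := nest m (n - m.+1) (r n).
  have e1 : m + (n - m.+1) = n.-1 by lia.
  have e2 : n.-1.+1 = n by lia.
  rewrite e1 e2 -e => h.
  have am : adj (r m) (r m.+1) by [].
  have := branch_self am; move=> /(branch_disjoint am); apply; apply: h.
  by rewrite e; apply: branch_self; rewrite adj_sym -{2}e2; exact: ra.
move=> m n e; case: (ltngtP m n) => // /lt_neq; first by move/(_ e).
by move/(_ (esym e)).
Qed.

(** Read [P u v] as the edge pointing towards [u]. A vertex to which all its edges point attracts
    every edge, by monotonicity. If there is none, each vertex has an edge pointing away from it;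
    following such edges never backtracks and yields the ray. *)
Lemma orientation_limit (P : T -> T -> Prop) :
  (forall u v, adj u v -> P u v \/ P v u) ->
  (forall u v, adj u v -> P u v -> P v u -> False) ->
  (forall u v u' v', adj u v -> adj u' v' -> branch u v `<=` branch u' v' ->
     P u v -> P u' v') ->
  (exists t, forall u v, adj u v -> branch u v t -> P u v) \/
  (exists2 r, ray r & forall u v, adj u v -> has_tail_in r (branch u v) -> P u v).
Proof.
move=> Por Pexcl Psub.
have [[t Ht]|nH] := pselect (exists t, forall u, adj t u -> P t u).
  left; exists t => u v uv ut; have [//|Pvu] := Por _ _ uv; exfalso.
  have vu : adj v u by rewrite adj_sym.
  have tv : t <> v by move=> tv; apply: (component_off_notin ut).
  have [s ts sv] := toward_neighbour tv.
  have st : adj s t by rewrite adj_sym.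
  apply: (Pexcl _ _ ts (Ht _ ts)); apply: (Psub v u) => //.
  apply: component_off_sub => // z vz /= zt.
  by apply: (branch_disjoint uv) vz; rewrite zt.
right; have /choice[f Hf] : forall t, exists u, adj t u /\ P u t.
  move=> t; apply: contrapT => nt; apply: nH; exists t => u tu.
  by have [//|Put] := Por _ _ tu; case: nt; exists u.
have [[t0] _] := Ttree.1; pose r n := iter n f t0.
have ra n : adj (r n) (r n.+1) by exact: (Hf _).1.
have rP n : P (r n.+1) (r n) by exact: (Hf _).2.
have rr : ray r.
  apply: nonbacktracking_ray => // n e.
  by apply: (Pexcl _ _ (ra n)); [rewrite -{1}e; exact: rP|exact: rP].
exists r => // u v uv [M HM]; have [//|Pvu] := Por _ _ uv; exfalso.
have vu : adj v u by rewrite adj_sym.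
have [N1 H1] := ray_behind u rr; have [N2 H2] := ray_behind v rr.
pose n := maxn M (maxn N1 N2).
have := H2 n ltac:(lia); have := HM n.+1 ltac:(lia).
move=> un hv; apply: (Pexcl _ _ (ra n)) (rP n); apply: (Psub v u) => //.
apply: component_off_sub => // z vz /= zr.
by apply: (branch_disjoint uv) vz; rewrite zr.
Qed.

End Tree.

(** * Sides of a tree-decomposition *)

Section Decomposition.
Variables (X T : graph) (beta : T -> set X).
Hypothesis Xc : forall x y : X, reach x y.
Hypothesis td : tree_decomposition beta.
Implicit Types (x y z p : X) (a b c g : nat -> X) (s t u v : T).
Implicit Types (xi eta : boundary X) (w : ends T).

Let Ttree : is_tree T. Proof. by case: td. Qed.

Lemma side_branch u v : adj u v -> side beta u v = \bigcup_(s in branch u v) beta s.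
Proof. by move=> uv; rewrite /side reach_del_edge. Qed.

Lemma bag_side u v s x : adj u v -> branch u v s -> beta s x -> side beta u v x.
Proof. by move=> uv us sx; rewrite side_branch //; exists s. Qed.

Lemma bag_ex x : exists s, beta s x.
Proof. by case: td => _ H _ _; have : setT x by []; rewrite -H => -[s _]; exists s. Qed.

Lemma side_cover u v x : adj u v -> side beta u v x \/ side beta v u x.
Proof.
move=> uv; have [s sx] := bag_ex x; have vu : adj v u by rewrite adj_sym.
by have [h|h] := branch_cover Ttree s uv; [left|right]; exact: bag_side sx.
Qed.

(** The bags containing [x] form a connected subtree; meeting both branches, it uses the only edge
    between them. *)
Lemma side_meet u v x : adj u v -> side beta u v x -> side beta v u x ->
  adhesion beta u v x.
Proof.
move=> uv; rewrite !side_branch // 1?adj_sym // => -[s us sx] [t vt tx].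
apply: contrapT => nax.
have [_ _ _ /(_ x)[_ Tx]] := td.
have s' : s \in [set t | beta t x] by rewrite inE.
have t' : t \in [set t | beta t x] by rewrite inE.
have : branch u v t.
  move: (Tx (SigSub s') (SigSub t')) => R.
  have : branch u v (val (SigSub t' : induced [set t | beta t x])).
    move: (SigSub t' : induced [set t | beta t x]) R.
    apply: (@reach_ind (induced [set t | beta t x])) => //.
    move=> y z uy yz; apply: contrapT => nuz; apply: nax.
    have [yu zv] := branch_exit Ttree uv uy yz nuz.
    split; [rewrite -yu|rewrite -zv]; [have := valP y|have := valP z];
      by rewrite inE.
  by [].
by move/(branch_disjoint Ttree uv); apply.
Qed.

Lemma side_adj u v x y : adj u v -> adj x y ->
  side beta u v x /\ side beta u v y \/ side beta v u x /\ side beta v u y.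
Proof.
move=> uv xy; have [_ _ /(_ x y xy)[s [sx sy]] _] := td.
have vu : adj v u by rewrite adj_sym.
by have [h|h] := branch_cover Ttree s uv; [left|right]; split;
  apply: bag_side h _.
Qed.

Lemma adhesionC u v : adhesion beta u v = adhesion beta v u.
Proof. by rewrite /adhesion setIC. Qed.

Lemma side_sub u v u' v' : adj u v -> adj u' v' -> branch u v `<=` branch u' v' ->
  side beta u v `<=` side beta u' v'.
Proof. by move=> uv uv' H x; rewrite !side_branch // => -[s /H h sx]; exists s. Qed.

Lemma side_crossing u v c i j : adj u v -> i <= j ->
  (forall k, i <= k -> k < j -> adj (c k) (c k.+1)) ->
  side beta u v (c i) -> side beta v u (c j) ->
  exists k, [/\ i <= k, k <= j & adhesion beta u v (c k)].
Proof.
move=> uv ij ac ui vj.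
have [vi|nvi] := pselect (side beta v u (c i)).
  by exists i; split=> //; exact: side_meet.
have [|k [ik kj nvk vk]] := @crossing (fun k => ~ side beta v u (c k)) _ _ ij nvi.
  by move/(_ vj).
move/contrapT: vk => vk; exists k.+1; split; [lia|lia|].
by case: (side_adj uv (ac k ik kj)) => -[h1 h2] //; exact: side_meet.
Qed.

Lemma segment_adj g l k : segment g l -> k < l -> adj (g k) (g k.+1).
Proof. by move=> sg kl; apply: dist1_adj => //; rewrite sg // subSnn. Qed.

Lemma segment_crossing u v g l i j : segment g l -> adj u v -> i <= j -> j <= l ->
  side beta u v (g i) -> side beta v u (g j) ->
  exists k, [/\ i <= k, k <= j & adhesion beta u v (g k)].
Proof.
move=> sg uv ij jl; apply: side_crossing => // k _ kj.
apply: (segment_adj sg); lia.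
Qed.

Lemma dist_side_crossing u v x y : adj u v -> side beta u v x -> side beta v u y ->
  exists z, adhesion beta u v z /\ dist x y = dist x z + dist z y.
Proof.
move=> uv ux vy; have [g [g0 gl sg]] := exists_segment Xc x y.
have [||k [_ kl zk]] := segment_crossing sg uv (leq0n _) (leqnn _).
- by rewrite g0.
- by rewrite gl.
exists (g k); split=> //.
have := sg 0 k (leq0n _) kl; have := sg k _ kl (leqnn _).
by rewrite g0 (gl _ (leqnn _)); lia.
Qed.

Hypothesis adhesion_finite : forall u v, adj u v -> finite_set (adhesion beta u v).

Lemma geodesic_ray_crossing a u v i j : geodesic_ray a -> adj u v -> i <= j ->
  side beta u v (a i) -> side beta v u (a j) ->
  exists k, [/\ i <= k, k <= j & adhesion beta u v (a k)].
Proof.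
move=> ga uv ij; apply: side_crossing => // k _ _; exact: geodesic_ray_adj.
Qed.

Lemma geodesic_tail_side a u v : geodesic_ray a -> adj u v ->
  has_tail_in a (side beta u v) \/ has_tail_in a (side beta v u).
Proof.
move=> ga uv; have vu : adj v u by rewrite adj_sym.
have [N HN] := inj_escape (geodesic_ray_inj ga) (adhesion_finite uv).
have stay u' v' : adj u' v' -> adhesion beta u' v' = adhesion beta u v ->
    side beta u' v' (a N) -> has_tail_in a (side beta u' v').
  move=> uv' e h; exists N => n Nn.
  have [//|h'] := side_cover (a n) uv'; exfalso.
  have [k [Nk _]] := geodesic_ray_crossing ga uv' Nn h h'.
  by rewrite e; exact: HN.
by have [h|h] := side_cover (a N) uv; [left|right]; apply: stay => //;
  exact: adhesionC.
Qed.

Lemma geodesic_tail_excl a u v : geodesic_ray a -> adj u v ->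
  has_tail_in a (side beta u v) -> has_tail_in a (side beta v u) -> False.
Proof.
move=> ga uv h1 h2; have [N HN] := has_tail_in_meet h1 h2.
have [M HM] := inj_escape (geodesic_ray_inj ga) (adhesion_finite uv).
have [h3 h4] := HN (maxn N M) (leq_maxl _ _).
by apply: (HM (maxn N M) (leq_maxr _ _)); exact: side_meet.
Qed.

(** A tail on the other side would have all its late points within [C] of the adhesion set, since a
    geodesic to [y] has to cross it; but a geodesic ray escapes from a finite set. *)
Lemma geodesic_tail_near a u v C N : geodesic_ray a -> adj u v ->
  (forall k, N <= k -> exists2 y, side beta u v y & dist (a k) y <= C) ->
  has_tail_in a (side beta u v).
Proof.
move=> ga uv H; have [//|[M HM]] := geodesic_tail_side ga uv; exfalso.
have vu : adj v u by rewrite adj_sym.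
have [K HK] := geodesic_escape Xc ga (adhesion_finite vu).
pose n := N + M + K + C + 1.
have [y uy dy] := H n ltac:(lia).
have [z [az]] := dist_side_crossing vu (HM n ltac:(lia)) uy.
have := HK n ltac:(lia) z az.
rewrite (distC Xc z (a n)); have : n = N + M + K + C + 1 by []; lia.
Qed.

Lemma tail_side_hausdorff a b u v : geodesic_ray a -> geodesic_ray b ->
  finite_hausdorff a b -> adj u v ->
  has_tail_in a (side beta u v) -> has_tail_in b (side beta u v).
Proof.
move=> ga gb /(finite_hausdorff_bounded Xc ga gb)[C HC] uv [N HN].
apply: (@geodesic_tail_near _ _ _ C N) => // k Nk; exists (a k); first exact: HN.
by rewrite distC.
Qed.

Definition boundary_side u v : set (boundary X) :=
  [set xi | forall a, sval xi a -> has_tail_in a (side beta u v)].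

Lemma boundary_sideP u v xi a : adj u v -> sval xi a ->
  boundary_side u v xi <-> has_tail_in a (side beta u v).
Proof.
move=> uv xa; split=> [|h b xb]; first exact.
apply: tail_side_hausdorff h => //.
- exact: boundary_geodesic xa.
- exact: boundary_geodesic xb.
- exact: boundary_hausdorff xa xb.
Qed.

Lemma boundary_side_or u v xi : adj u v ->
  boundary_side u v xi \/ boundary_side v u xi.
Proof.
move=> uv; have [a xa] := boundary_ex xi; have vu : adj v u by rewrite adj_sym.
have [h|h] := geodesic_tail_side (boundary_geodesic xa) uv; [left|right];
  by apply/(boundary_sideP _ xa).
Qed.

Lemma boundary_side_excl u v xi : adj u v ->
  boundary_side u v xi -> boundary_side v u xi -> False.
Proof.
move=> uv h1 h2; have [a xa] := boundary_ex xi.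
exact: geodesic_tail_excl (boundary_geodesic xa) uv (h1 _ xa) (h2 _ xa).
Qed.

Lemma boundary_side_sub u v u' v' xi : adj u v -> adj u' v' ->
  branch u v `<=` branch u' v' -> boundary_side u v xi -> boundary_side u' v' xi.
Proof.
by move=> uv uv' H h a /h; apply: has_tail_in_sub; exact: side_sub.
Qed.

(** Rays that end up on different sides are separated by the adhesion set, so their Gromov product
    at [p] is at most the largest distance from [p] to that set. The radius is the same for all
    [xi]. *)
Lemma boundary_side_nbhs u v p : adj u v -> exists r, forall xi,
  boundary_side u v xi -> boundary_nbhs p r xi `<=` boundary_side u v.
Proof.
move=> uv; have [M HM] := finite_ub (dist p) (adhesion_finite uv).
exists M.+1 => xi h eta /(boundary_nbhs_elim)[a [b [N [xa eb ap bp H]]]].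
have [//|h'] := boundary_side_or eta uv; exfalso.
have [N1 H1] := h a xa; have [N2 H2] := h' b eb.
pose n := maxn N (maxn N1 N2).
have [z [az e]] := dist_side_crossing uv (H1 n ltac:(lia)) (H2 n ltac:(lia)).
have := H n ltac:(lia); have := HM z az.
have := boundary_geodesic xa; have := boundary_geodesic eb.
move=> /(_ 0 n (leq0n _)) + /(_ 0 n (leq0n _)); rewrite ap bp.
have := dist_triangle Xc z p (a n); have := dist_triangle Xc z p (b n).
by rewrite (distC Xc z (a n)); lia.
Qed.

Lemma boundary_side_open u v : adj u v -> open (boundary_side u v).
Proof.
move=> uv; rewrite boundary_openE => p xi h; have [r H] := boundary_side_nbhs p uv.
by exists r; exact: H.
Qed.

(** [sinks] and [directed] are the two outcomes of [orientation_limit] for the orientation of the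
    edges of [T] induced by [xi]: towards a vertex, or towards an end. *)
Definition sinks xi t := forall u v, adj u v -> branch u v t -> boundary_side u v xi.

Definition directed xi w := forall u v, adj u v -> end_tails_in w (branch u v) ->
  boundary_side u v xi.

Lemma sinks_or_directed xi : (exists t, sinks xi t) \/ (exists w, directed xi w).
Proof.
have [| | |h|[r rr h]] := @orientation_limit T Ttree
    (fun u v => boundary_side u v xi).
- by move=> u v; exact: boundary_side_or.
- by move=> u v; exact: boundary_side_excl.
- by move=> u v u' v'; exact: boundary_side_sub.
- by left.
right; exists (end_point rr) => u v uv /(_ _ (end_pointP rr)); exact: h.
Qed.

Lemma sinks_unique xi s t : sinks xi s -> sinks xi t -> s = t.
Proof.
move=> hs ht; apply: contrapT => /(separating_edge Ttree)[u [v [uv us vt]]].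
have vu : adj v u by rewrite adj_sym.
exact: boundary_side_excl uv (hs _ _ uv us) (ht _ _ vu vt).
Qed.

Lemma sinks_not_directed xi t w : sinks xi t -> directed xi w -> False.
Proof.
move=> ht hw; have [r wr] := ends_ex w; have rr := ends_ray wr.
have [N HN] := ray_behind Ttree t rr; have aN := rr.2 N.
have aN' : adj (r N.+1) (r N) by rewrite adj_sym.
apply: (boundary_side_excl aN (ht _ _ aN (HN _ (leqnn N)))).
by apply: hw => //; apply/(end_tailsP Ttree wr) => //; exact: ray_ahead.
Qed.

Lemma directed_functional xi w w' : directed xi w -> directed xi w' -> w = w'.
Proof.
move=> hw hw'; apply: (ends_eq Ttree) => u v uv h.
have [//|h'] := end_tails_or Ttree w' uv; exfalso.
have vu : adj v u by rewrite adj_sym.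
exact: boundary_side_excl uv (hw _ _ uv h) (hw' _ _ vu h').
Qed.

Lemma side_behind (r : nat -> T) x : ray r -> exists N, forall n, N <= n ->
  side beta (r n) (r n.+1) x.
Proof.
move=> rr; have [s sx] := bag_ex x; have [N HN] := ray_behind Ttree s rr.
by exists N => n /HN h; exact: bag_side (rr.2 n) h sx.
Qed.

Lemma side_behind_ball (r : nat -> T) p K : locally_finite X -> ray r ->
  exists N, forall n, N <= n -> forall x, dist p x <= K -> side beta (r n) (r n.+1) x.
Proof.
move=> Xlf rr; apply: finite_eventually => [|x _]; last exact: side_behind.
exact: finite_ball.
Qed.

End Decomposition.

(** * Paths that stay inside a bag *)

Section BagPaths.
Variable X : graph.

Definition path_within (A : set X) (x y : X) (n : nat) := exists s : seq X,
  [/\ path (@adj X) x s, last x s = y, size s <= n & forall z, z \in x :: s -> A z].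

Lemma path_within_refl A x : A x -> path_within A x x 0.
Proof. by move=> Ax; exists [::]; split=> // z; rewrite inE => /eqP->. Qed.

Lemma path_within_leq A x y m n : m <= n -> path_within A x y m -> path_within A x y n.
Proof. by move=> mn [s [? ? sm ?]]; exists s; split=> //; exact: leq_trans mn. Qed.

Lemma path_within_trans A y x z m n : path_within A x y m -> path_within A y z n ->
  path_within A x z (m + n).
Proof.
move=> [s [ps ls sm sA]] [t [pt lt tn tA]]; exists (s ++ t); split.
- by rewrite cat_path ps ls.
- by rewrite last_cat ls.
- by rewrite size_cat leq_add.
- move=> w; rewrite -cat_cons mem_cat => /orP[/sA//|wt].
  by apply: tA; rewrite inE wt orbT.
Qed.

Lemma path_within_adj A x y : A x -> A y -> adj x y -> path_within A x y 1.
Proof.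
by move=> Ax Ay xy; exists [:: y]; split; rewrite /= ?xy // => z; rewrite !inE
  => /orP[]/eqP->.
Qed.

Lemma induced_lift (A : set X) (x : induced A) (s : seq X) :
  path (@adj X) (val x) s -> (forall z, z \in s -> A z) ->
  exists2 q : seq (induced A), path (@adj (induced A)) x q & map val q = s.
Proof.
elim: s x => [|y s IH] x /=; first by exists [::].
move=> /andP[xy ys] sA.
have Ay : y \in A by rewrite inE; apply: sA; rewrite inE eqxx.
have [||q pq qs] := IH (SigSub Ay : induced A).
- exact: ys.
- by move=> z zs; apply: sA; rewrite inE zs orbT.
exists ((SigSub Ay : induced A) :: q); last by rewrite /= qs.
by rewrite /= pq andbT.
Qed.

Lemma path_within_dist (A : set X) (x y : induced A) n :
  path_within A (val x) (val y) n -> dist x y <= n.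
Proof.
move=> [s [ps ls sn sA]].
have [|q pq qs] := induced_lift ps.
  by move=> z zs; apply: sA; rewrite inE zs orbT.
apply: leq_trans sn; rewrite -qs size_map.
have -> : y = last x q by apply: val_inj; rewrite -ls -qs last_map.
exact: dist_le_size.
Qed.

Lemma path_within_ex (A : set X) (x y : X) : connected_graph (induced A) ->
  A x -> A y -> exists n, path_within A x y n.
Proof.
move=> [_ cA] Ax Ay.
have Ax' : x \in A by rewrite inE.
have Ay' : y \in A by rewrite inE.
have [q [pq lq]] := cA (SigSub Ax') (SigSub Ay').
exists (size q), (map val q); split.
- suff H (z : induced A) : path (@adj (induced A)) z q ->
    path (@adj X) (val z) (map val q) by exact: (H _ pq).
  by elim: q z {pq lq} => //= w q IH z /andP[zw /IH->]; rewrite andbT.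
- by rewrite -[x]/(val (SigSub Ax' : induced A)) last_map lq.
- by rewrite size_map.
- move=> z; rewrite -[x]/(val (SigSub Ax' : induced A)) -map_cons => /mapP[w _ ->].
  by have := valP w; rewrite inE.
Qed.

Lemma dist_induced (A : set X) (x y : induced A) : reach x y ->
  dist (val x) (val y) <= dist x y.
Proof.
move=> /reach_geod[q [pq <- <-]]; rewrite -last_map -(size_map val q).
apply: dist_le_size.
by elim: q x pq => //= w q IH z /andP[zw /IH->]; rewrite andbT.
Qed.

End BagPaths.

(** * Boundaries of bags and ends of the tree *)

Section Bags.
Variables (X T : graph) (beta : T -> set X).
Hypothesis Xc : forall x y : X, reach x y.
Hypothesis Xlf : locally_finite X.
Variable D : nat.
Hypothesis hyp : four_point X D.
Hypothesis td : tree_decomposition beta.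
Hypothesis bags_connected : forall t, connected_graph (induced (beta t)).
Hypothesis adhesion_finite : forall u v, adj u v -> finite_set (adhesion beta u v).
Variable L : nat.
Hypothesis adhesion_path : forall u v, adj u v -> forall x y,
  adhesion beta u v x -> adhesion beta u v y -> path_within (beta u) x y L.

Let Ttree : is_tree T. Proof. by case: td. Qed.

Lemma adhesion_diam u v x y : adj u v ->
  adhesion beta u v x -> adhesion beta u v y -> dist x y <= L.
Proof.
move=> uv ux uy; have [s [ps <- sL _]] := adhesion_path uv ux uy.
exact: leq_trans (dist_le_size ps) sL.
Qed.

(** Every edge inside the bag costs one, and every excursion of [k] edges, [k] at least one, is
    replaced by a path of length at most [L]; hence the factor [L.+1]. *)
Lemma bag_shortcut t n (c : nat -> X) :
  (forall i, i < n -> adj (c i) (c i.+1)) -> beta t (c 0) -> beta t (c n) ->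
  path_within (beta t) (c 0) (c n) (L.+1 * n).
Proof.
elim/ltn_ind: n c => n IH c ac t0 tn.
case: n => [|n] in IH ac tn *; first by rewrite muln0; exact: path_within_refl.
have [t1|nt1] := pselect (beta t (c 1)).
  have h := IH n (ltnSn n) (fun i => c i.+1) (fun i h => ac i.+1 h) t1 tn.
  apply: path_within_leq (path_within_trans (path_within_adj t0 t1 (ac 0 isT)) h).
  by rewrite mulnS; lia.
have [_ _ /(_ _ _ (ac 0 isT))[s [s0 s1]] _] := td.
have ts : t <> s by move=> ts; apply: nt1; rewrite ts.
have [u tu us] := toward_neighbour Ttree ts.
have ut : adj u t by rewrite adj_sym.
(* [c 0] lies in the bag of [t] and in the bag of [s], which is beyond the edge [tu], so it already
   belongs to the adhesion set. *)
have S0 : adhesion beta t u (c 0).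
  apply: (side_meet td tu); last exact: (bag_side td ut us s0).
  exact: (bag_side td tu (branch_self tu) t0).
(* The excursion beyond [tu] can come back to the bag of [t] only through the same adhesion set. *)
have [k [k1 kn Sk]] := side_crossing td ut (ltn0Sn n)
  (fun k _ h => ac k h) (bag_side td ut us s1) (bag_side td tu (branch_self tu) tn).
have Sk' : adhesion beta t u (c k) by rewrite adhesionC.
have h1 := adhesion_path tu S0 Sk'.
have h2 := IH (n.+1 - k) ltac:(lia) (fun i => c (k + i)).
rewrite /= addn0 subnKC // in h2.
have {}h2 := h2 _ Sk'.1 tn.
apply: path_within_leq (path_within_trans h1 (h2 _)).
  have -> : L.+1 * n.+1 = L.+1 * k + L.+1 * (n.+1 - k) by rewrite -mulnDr subnKC.
  rewrite leq_add2r; apply: (@leq_trans (L.+1 * 1)); first by rewrite muln1.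
  by rewrite leq_mul2l k1 orbT.
by move=> i h; rewrite addnS; apply: ac; lia.
Qed.

(** * A single bag and its boundary *)

Section OneBag.
Variable t : T.
Notation A := (induced (beta t)).

Let Ac : forall x y : A, reach x y. Proof. by case: (bags_connected t). Qed.

Lemma bag_val (x : A) : beta t (val x).
Proof. by have := valP x; rewrite inE. Qed.

Lemma bag_dist_le (x y : A) : dist (val x) (val y) <= dist x y.
Proof. exact: dist_induced. Qed.

Lemma bag_dist_ge (x y : A) : dist x y <= L.+1 * dist (val x) (val y).
Proof.
have [g [g0 gl sg]] := exists_segment Xc (val x) (val y).
apply: path_within_dist; rewrite -{1}g0 -{1}(gl _ (leqnn _)).
apply: bag_shortcut; [|by rewrite g0; exact: bag_val|by rewrite gl //; exact: bag_val].
by move=> i; exact: segment_adj sg.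
Qed.

Lemma bag_locally_finite : locally_finite A.
Proof.
move=> x; apply: (@finite_preimage _ _ [set y | adj (val x) y] val).
  by move=> ? ? _ _; exact: val_inj.
exact: Xlf.
Qed.

Definition bag_seq (c : nat -> A) : nat -> X := fun n => val (c n).

Lemma bag_quasi_geodesic (c : nat -> A) l : segment c l ->
  quasi_geodesic L.+1 (bag_seq c) l.
Proof.
move=> sc i j ij jl; rewrite -(sc i j ij jl).
by split; [exact: bag_dist_le|exact: bag_dist_ge].
Qed.

Lemma bag_hausdorff (c c' : nat -> A) :
  finite_hausdorff (bag_seq c) (bag_seq c') <-> finite_hausdorff c c'.
Proof.
split=> -[C [H1 H2]].
  exists (L.+1 * C); split=> m.
    have [n h] := H1 m; exists n; apply: leq_trans (bag_dist_ge _ _) _.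
    by rewrite leq_mul2l h orbT.
  have [n h] := H2 m; exists n; apply: leq_trans (bag_dist_ge _ _) _.
  by rewrite leq_mul2l h orbT.
exists C; split=> m.
  by have [n h] := H1 m; exists n; apply: leq_trans (bag_dist_le _ _) h.
by have [n h] := H2 m; exists n; apply: leq_trans (bag_dist_le _ _) h.
Qed.

Variable K : nat.
Hypothesis morse : forall (c : nat -> X) n (g : nat -> X) l,
  quasi_geodesic L.+1 c n -> segment g l -> g 0 = c 0 -> g l = c n ->
  (forall s, s <= l -> exists2 i, i <= n & dist (g s) (c i) <= K) /\
  (forall i, i <= n -> exists2 s, s <= l & dist (g s) (c i) <= K).

(** Finite Hausdorff distance with the Morse constant made explicit; the two continuity proofs need
    this uniformity. *)
Definition tracks (a : nat -> X) (c : nat -> A) :=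
  (forall k, exists i, dist (a k) (bag_seq c i) <= K) /\
  (forall i, exists k, dist (a k) (bag_seq c i) <= K).

Lemma tracks_hausdorff a c : tracks a c -> finite_hausdorff a (bag_seq c).
Proof. by move=> h; exists K. Qed.

Lemma bag_ray_straighten (c : nat -> A) : geodesic_ray c ->
  exists a, [/\ geodesic_ray a, a 0 = val (c 0) & tracks a c].
Proof.
move=> gc.
have /choice[g Hg] n := exists_segment Xc (val (c 0)) (val (c n)).
pose l n := dist (val (c 0)) (val (c n)).
have nl n : n <= L.+1 * l n.
  by have := bag_dist_ge (c 0) (c n); rewrite gc // subn0.
have qc n : quasi_geodesic L.+1 (bag_seq c) n.
  by apply: bag_quasi_geodesic => i j ij _; exact: gc.
have g0 n : g n 0 = val (c 0) by have [] := Hg n.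
have gl n : g n (l n) = val (c n) by have [_ h _] := Hg n; exact: h.
have sg n : segment (g n) (l n) by have [] := Hg n.
have M n := morse (qc n) (sg n) (g0 n) (gl n).
have [|||| a [ga a0 H]] := limit_ray Xc Xlf (c := g) (l := l) (p := val (c 0)) => //.
- by move=> n i li; have [_ h _] := Hg n; rewrite gl h.
- move=> m; exists (L.+1 * m) => n h; have := leq_trans h (nl n).
  by rewrite leq_pmul2l.
exists a; split=> //; split=> [k|i].
  have [n _ [kl ag]] := H k 0; have [i _ hi] := (M n).1 k kl.
  by exists i; rewrite -ag.
(* A point [g n s] within [K] of [c i] has [s] at most [i + K], so it lies on the part where [g n]
   agrees with [a]. *)
have [n ni [il ag]] := H (i + K) i; have [s sl hs] := (M n).2 i ni.
exists s; rewrite -ag //.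
have := sg n 0 s (leq0n _) sl; rewrite g0.
have := dist_triangle Xc (val (c i)) (val (c 0)) (g n s).
have := bag_dist_le (c 0) (c i); rewrite gc // subn0.
by move: hs; rewrite (distC Xc (g n s)) /bag_seq; lia.
Qed.

(** Outside the bag the ray is beyond some edge at [t]. It must come back to the side of [t], and it
    does so through an adhesion set contained in the bag. *)
Lemma sink_returns xi a : sinks beta xi t -> sval xi a ->
  forall N, exists2 k, N <= k & beta t (a k).
Proof.
move=> xit xa N; apply: contrapT => H; have ga := boundary_geodesic xa.
have nt k : N <= k -> ~ beta t (a k) by move=> Nk tk; apply: H; exists k.
have [s sN] := bag_ex td (a N).
have ts : t <> s by move=> ts; apply: (nt N) => //; rewrite ts.
have [u tu us] := toward_neighbour Ttree ts.
have ut : adj u t by rewrite adj_sym.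
have [M HM] := xit _ _ tu (branch_self tu) a xa.
have [k [Nk _ Sk]] := geodesic_ray_crossing Xc td ga ut (leq_maxl N M)
  (bag_side td ut us sN) (HM _ (leq_maxr _ _)).
by apply: (nt k Nk); case: Sk.
Qed.

(** The counterpart of [bag_ray_straighten]: [c] is a limit of geodesics of the bag from [q] to the
    points at which [a] returns, each of them close to an initial segment of [a]. *)
Lemma sink_ray_in_bag xi a (q : A) : sinks beta xi t -> sval xi a -> a 0 = val q ->
  exists c, [/\ geodesic_ray c, c 0 = q & tracks a c].
Proof.
move=> xit xa aq; have ga := boundary_geodesic xa.
have /choice[f Hf] n : exists k : nat * A, n <= k.1 /\ val k.2 = a k.1.
  have [k nk tk] := sink_returns xit xa n.
  have tk' : a k \in beta t by rewrite inE.
  by exists (k, SigSub tk' : A).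
have /choice[g Hg] n := exists_segment Ac q (f n).2.
pose l n := dist q (f n).2.
have fl n : n <= l n.
  apply: leq_trans (Hf n).1 _; apply: leq_trans (bag_dist_le _ _).
  by rewrite (Hf n).2 -aq ga // subn0.
have g0 n : g n 0 = q by have [] := Hg n.
have gl n : g n (l n) = (f n).2 by have [_ h _] := Hg n; exact: h.
have sg n : segment (g n) (l n) by have [] := Hg n.
have M n : (forall s, s <= (f n).1 -> exists2 i, i <= l n &
      dist (a s) (bag_seq (g n) i) <= K) /\
    (forall i, i <= l n -> exists2 s, s <= (f n).1 &
      dist (a s) (bag_seq (g n) i) <= K).
  have sa : segment a (f n).1 by move=> i j ij _; exact: ga.
  apply: (morse (bag_quasi_geodesic (sg n)) sa); first by rewrite /bag_seq g0.
  by rewrite /bag_seq gl (Hf n).2.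
have [|||| c [gc c0 H]] := limit_ray Ac bag_locally_finite (c := g) (l := l) (p := q) => //.
- by move=> n i li; have [_ h _] := Hg n; rewrite gl h.
- by move=> m; exists m => n h; exact: leq_trans (fl n).
exists c; split=> //; split=> [k|i].
  (* The point of [g n] near [a k] is within [k + K] of [q] in [X], so its index, a distance in the
     bag, is at most [L.+1 * (k + K)]. *)
  have [n kn [ml ag]] := H (L.+1 * (k + K)) k.
  have [i il hi] := (M n).1 k (leq_trans kn (Hf n).1).
  exists i; rewrite /bag_seq -ag //.
  have := sg n 0 i (leq0n _) il; rewrite g0 subn0 => <-.
  apply: leq_trans (bag_dist_ge _ _) _; rewrite leq_pmul2l //.
  have := dist_triangle Xc (a k) (val q) (bag_seq (g n) i).
  by rewrite -aq ga // /bag_seq; move: hi; rewrite /bag_seq; lia.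
have [n _ [il ag]] := H i 0; have [k _ hk] := (M n).2 i il.
by exists k; rewrite /bag_seq -ag.
Qed.

Definition bag_rel (xi : boundary X) (zeta : boundary A) := exists a c,
  [/\ sval xi a, sval zeta c & finite_hausdorff a (bag_seq c)].

Lemma bag_relP xi zeta a c : bag_rel xi zeta -> sval xi a -> sval zeta c ->
  finite_hausdorff a (bag_seq c).
Proof.
move=> [b [d [xb zd bd]]] xa zc.
apply: finite_hausdorff_trans (boundary_hausdorff Xc xa xb) _ => //.
apply: finite_hausdorff_trans bd _ => //.
by apply/bag_hausdorff; exact: boundary_hausdorff zd zc.
Qed.

Lemma bag_rel_functional xi zeta zeta' :
  bag_rel xi zeta -> bag_rel xi zeta' -> zeta = zeta'.
Proof.
move=> h h'; have [a xa] := boundary_ex xi.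
have [c zc] := boundary_ex zeta; have [c' zc'] := boundary_ex zeta'.
apply: (boundary_eq Ac zc zc'); apply/bag_hausdorff.
apply: finite_hausdorff_trans (bag_relP h' xa zc') => //.
by apply: finite_hausdorff_sym => //; exact: bag_relP h xa zc.
Qed.

Lemma bag_rel_injective xi xi' zeta :
  bag_rel xi zeta -> bag_rel xi' zeta -> xi = xi'.
Proof.
move=> h h'; have [a xa] := boundary_ex xi; have [a' xa'] := boundary_ex xi'.
have [c zc] := boundary_ex zeta.
apply: (boundary_eq Xc xa xa').
apply: finite_hausdorff_trans (bag_relP h xa zc) _ => //.
by apply: finite_hausdorff_sym => //; exact: bag_relP h' xa' zc.
Qed.

Lemma bag_rel_total zeta : exists xi, bag_rel xi zeta.
Proof.
have [c zc] := boundary_ex zeta.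
have [a [ga _ /tracks_hausdorff ac]] := bag_ray_straighten (boundary_geodesic zc).
by exists (boundary_point ga), a, c; split => //; exact: boundary_pointP.
Qed.

Lemma bag_rel_sinks xi zeta : bag_rel xi zeta -> sinks beta xi t.
Proof.
move=> [a [c [xa zc [C [H _]]]]] u v uv ut.
apply/(boundary_sideP Xc td adhesion_finite uv xa).
apply: (@geodesic_tail_near _ _ _ Xc td adhesion_finite _ _ _ C 0) => //.
  exact: boundary_geodesic xa.
move=> k _; have [n Hn] := H k; exists (bag_seq c n) => //.
by apply: (bag_side td uv ut); exact: bag_val.
Qed.

Lemma sinks_bag_rel xi : sinks beta xi t -> exists zeta, bag_rel xi zeta.
Proof.
move=> xit; have [[q] _] := bags_connected t.
have [a xa aq] := boundary_ray_from Xc Xlf hyp xi (val q).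
have [c [gc _ /tracks_hausdorff ac]] := sink_ray_in_bag xit xa aq.
by exists (boundary_point gc), a, c; split=> //; exact: boundary_pointP.
Qed.

Lemma bag_rel_tracks xi zeta a c : bag_rel xi zeta -> sval xi a -> sval zeta c ->
  a 0 = val (c 0) -> forall i, exists k, dist (a k) (bag_seq c i) <= K + 2 * D.
Proof.
move=> h xa zc ac0 i; have gc := boundary_geodesic zc.
have [b [gb b0 bc]] := bag_ray_straighten gc.
have ga := boundary_geodesic xa.
have ab : finite_hausdorff a b.
  apply: finite_hausdorff_trans (bag_relP h xa zc) _ => //.
  by apply: finite_hausdorff_sym => //; exact: tracks_hausdorff.
have [k hk] := bc.2 i; exists k.
have := hausdorff_fellow_travel Xc hyp ga gb ab k.
rewrite b0 -ac0 distxx.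
by have := dist_triangle Xc (b k) (a k) (bag_seq c i); lia.
Qed.

(** Continuity of the embedding into [boundary X]: a bag geodesic far from [p] forces, by the Morse
    lemma, the geodesic of [X] with the same ends to be far from [p], which bounds the Gromov
    product in [X] from below. *)
Lemma bag_rel_open_boundary (O : set (boundary X)) : open O ->
  open [set zeta : boundary A | forall xi, bag_rel xi zeta -> O xi].
Proof.
rewrite !boundary_openE => oO p zeta Uz.
have [xi xz] := bag_rel_total zeta.
have [r Hr] := oO (val p) xi (Uz xi xz).
pose K' := K + 2 * D.
(* [K] is lost in passing to the geodesic of [X], [D + 1] in [product_ge_dist], and [K'] for each
   end replaced by a point of [a] or [a'], counted once in the distance and once in the index. *)
pose R1 := K + r + 2 * K' + D + 1.
exists (L.+1 * R1) => zeta' /boundary_nbhs_elim[c [c' [N [zc zc' c0 c0' HN]]]].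
move=> xi' xz'; apply: Hr.
have [a xa a0] := boundary_ray_from Xc Xlf hyp xi (val p).
have [a' xa' a0'] := boundary_ray_from Xc Xlf hyp xi' (val p).
have [i Hi] := bag_rel_tracks xz xa zc (etrans a0 (f_equal val (esym c0))) N.
have [j Hj] := bag_rel_tracks xz' xa' zc' (etrans a0' (f_equal val (esym c0'))) N.
apply: (boundary_nbhs_intro Xc xa xa' a0 a0' (m := i) (n := j)).
have [g [g0 gl sg]] := exists_segment Xc (bag_seq c N) (bag_seq c' N).
have [e [e0 el se]] := exists_segment Ac (c N) (c' N).
have M := morse (bag_quasi_geodesic se) sg.
rewrite /bag_seq e0 (el _ (leqnn _)) in M.
have {M}[M _] := M g0 (gl _ (leqnn _)).
have far : forall s, s <= dist (bag_seq c N) (bag_seq c' N) -> R1 - K <= dist (val p) (g s).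
  move=> s sl; have [k kl hk] := M s sl.
  (* A geodesic never comes closer to [p] than the Gromov product of its ends; the factor [L.+1] is
     spent on passing from the bag metric to that of [X]. *)
  have pe : L.+1 * R1 <= dist p (e k).
    have := HN N (leqnn N).
    have := boundary_geodesic zc; move=> /(_ 0 N (leq0n _)); rewrite c0.
    have := boundary_geodesic zc'; move=> /(_ 0 N (leq0n _)); rewrite c0'.
    have := se 0 k (leq0n _) kl; have := se k _ kl (leqnn _).
    rewrite e0 (el _ (leqnn _)) => h1 h2 h3 h4.
    have := dist_triangle Ac (e k) p (c N).
    have := dist_triangle Ac (e k) p (c' N).
    rewrite (distC Ac (e k) (c N)).
    by move: (L.+1 * R1) => m; lia.
  have := leq_trans pe (bag_dist_ge p (e k)); rewrite leq_pmul2l // => h.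
  have := dist_triangle Xc (g s) (val p) (val (e k)); lia.
have := product_ge_dist Xc hyp sg g0 (gl _ (leqnn _)) far.
have := boundary_geodesic xa; move=> /(_ 0 i (leq0n _)); rewrite a0.
have := boundary_geodesic xa'; move=> /(_ 0 j (leq0n _)); rewrite a0'.
have := dist_triangle Xc (a i) (val p) (bag_seq c N).
have := dist_triangle Xc (a' j) (val p) (bag_seq c' N).
have := dist_triangle Xc (bag_seq c N) (a i) (a' j).
have := dist_triangle Xc (bag_seq c' N) (bag_seq c N) (a' j).
rewrite (distC Xc (bag_seq c' N) (a' j)).
have : K' = K + 2 * D by []. have : R1 = K + r + 2 * K' + D + 1 by [].
move: Hi Hj; rewrite -/K'; move: (K') (R1) => k1 r1; lia.
Qed.

(** Continuity of the inverse. Points of [boundary X] outside the image satisfy the condition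
    vacuously, so openness there expresses that the image is closed. *)
Lemma bag_rel_open_bag (O : set (boundary A)) : open O ->
  open [set xi : boundary X | forall zeta, bag_rel xi zeta -> O zeta].
Proof.
rewrite !boundary_openE => oO p xi Ux.
have [xit|nxit] := pselect (sinks beta xi t); last first.
  have [u [v [uv ut nuv]]] : exists u v,
      [/\ adj u v, branch u v t & ~ boundary_side beta u v xi].
    apply: contrapT => H; apply: nxit => u v uv ut; apply: contrapT => nuv.
    by apply: H; exists u, v.
  have vu : adj v u by rewrite adj_sym.
  have vuxi : boundary_side beta v u xi.
    by have [] := boundary_side_or Xc td adhesion_finite xi uv.
  have [r Hr] := boundary_side_nbhs Xc td adhesion_finite p vu.
  exists r => xi' /(Hr xi vuxi) h zeta' /bag_rel_sinks /(_ _ _ uv ut) h'.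
  by case: (boundary_side_excl td adhesion_finite uv h' h).
have [zeta xz] := sinks_bag_rel xit.
have [[q] _] := bags_connected t.
have [R HR] := oO q zeta (Ux zeta xz).
(* At time [r1] the rays of [X] are within [2 * D], so the points of the bag rays near them are
   within [L.+1 * (2 * K + 2 * D)] in the bag; half of this and the [K] lost in the index are added
   to [R]. *)
pose r1 := R + K + L.+1 * (K + D).
have [r' Hr'] := boundary_nbhs_rebase Xc Xlf hyp p (val q) r1.
exists r' => xi' /(Hr' xi)/boundary_nbhs_elim[a [a' [N [xa xa' a0 a0' HN]]]].
move=> zeta' xz'; apply: HR.
have [c [gc c0 ac]] := sink_ray_in_bag xit xa a0.
have [c' [gc' c0' ac']] := sink_ray_in_bag (bag_rel_sinks xz') xa' a0'.
have zc : sval zeta c.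
  rewrite (bag_rel_functional xz (zeta' := boundary_point gc)).
    exact: boundary_pointP.
  by exists a, c; split=> //; [exact: boundary_pointP|exact: tracks_hausdorff].
have zc' : sval zeta' c'.
  rewrite (bag_rel_functional xz' (zeta' := boundary_point gc')).
    exact: boundary_pointP.
  by exists a', c'; split=> //; [exact: boundary_pointP|exact: tracks_hausdorff].
have [i Hi] := ac.1 r1; have [j Hj] := ac'.1 r1.
apply: (boundary_nbhs_intro Ac zc zc' c0 c0' (m := i) (n := j)).
have ga := boundary_geodesic xa; have ga' := boundary_geodesic xa'.
have ft := product_fellow_travel Xc hyp ga ga' (etrans a0 (esym a0')) (HN N (leqnn N)).
have dc : dist (c i) (c' j) <= L.+1 * (K + D) * 2.
  apply: leq_trans (bag_dist_ge _ _) _; rewrite -mulnA leq_pmul2l //.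
  have := dist_triangle Xc (a r1) (bag_seq c i) (bag_seq c' j).
  have := dist_triangle Xc (a' r1) (a r1) (bag_seq c' j).
  rewrite (distC Xc (bag_seq c i) (a r1)) /bag_seq.
  by move: Hi Hj ft; rewrite /bag_seq; lia.
have ci := gc 0 i (leq0n _); have cj := gc' 0 j (leq0n _).
rewrite c0 in ci; rewrite c0' in cj.
have := bag_dist_le q (c i); have := bag_dist_le q (c' j).
have := ga 0 r1 (leq0n _); have := ga' 0 r1 (leq0n _); rewrite a0 a0'.
have := dist_triangle Xc (bag_seq c i) (val q) (a r1).
have := dist_triangle Xc (bag_seq c' j) (val q) (a' r1).
rewrite (distC Xc (bag_seq c i) (a r1)) (distC Xc (bag_seq c' j) (a' r1)).
have : r1 = R + K + L.+1 * (K + D) by [].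
move: dc Hi Hj; rewrite /bag_seq; move: (L.+1 * (K + D)) (r1) => m s; lia.
Qed.

End OneBag.

(** * Boundary points that run to an end of the tree *)

Lemma directed_injective xi xi' w : directed beta xi w -> directed beta xi' w ->
  xi = xi'.
Proof.
move=> h h'; have [a xa] := boundary_ex xi; have [a' xa'] := boundary_ex xi'.
have ga := boundary_geodesic xa; have ga' := boundary_geodesic xa'.
apply: (boundary_eq Xc xa xa'); apply: bounded_finite_hausdorff.
apply: (fellow_travel Xc hyp ga ga' (C := L)) => N.
have [r wr] := ends_ex w; have rr := ends_ray wr.
have [N1 H1] := side_behind td (a N) rr; have [N2 H2] := side_behind td (a' N) rr.
pose n := maxn N1 N2; have rn := rr.2 n.
have rn' : adj (r n.+1) (r n) by rewrite adj_sym.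
have wn : end_tails_in w (branch (r n.+1) (r n)).
  by apply/(end_tailsP Ttree wr rn'); exact: ray_ahead.
have [M1 K1] := h _ _ rn' wn a xa; have [M2 K2] := h' _ _ rn' wn a' xa'.
have [i [Ni _ Si]] := geodesic_ray_crossing Xc td ga rn (leq_maxl N M1)
  (H1 n (leq_maxl _ _)) (K1 _ (leq_maxr _ _)).
have [j [Nj _ Sj]] := geodesic_ray_crossing Xc td ga' rn (leq_maxl N M2)
  (H2 n (leq_maxr _ _)) (K2 _ (leq_maxr _ _)).
by exists i, j; split=> //; exact: adhesion_diam Si Sj.
Qed.

Lemma directed_open_ends (O : set (ends T)) xi w : open O ->
  directed beta xi w -> O w -> exists U : set (boundary X),
  [/\ open U, U xi & forall xi' w', directed beta xi' w' -> U xi' -> O w'].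
Proof.
move=> oO h Ow; have [r wr] := ends_ex w; have rr := ends_ray wr.
have [N HN] := ends_open_nbhs Ttree oO Ow wr.
have rn : adj (r N.+1) (r N) by rewrite adj_sym; exact: rr.2.
exists (boundary_side beta (r N.+1) (r N)); split.
- exact: boundary_side_open.
- by apply: h => //; apply/(end_tailsP Ttree wr rn); exact: ray_ahead.
- move=> xi' w' h' Uxi'; apply: (HN N (leqnn N)).
  have [//|h2] := end_tails_or Ttree w' rn.
  by case: (boundary_side_excl td adhesion_finite rn Uxi' (h' _ _ (rr.2 N) h2)).
Qed.

(** The ball of radius [r0 + L] about [p] lies behind a late edge of [r]. Rays from [p] to points
    directed ahead cross its adhesion set at times at least [r0 + L], in points at most [L] apart,
    so their product is at least [r0]. *)
Lemma directed_open_boundary (O : set (boundary X)) xi w : inhabited X -> open O ->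
  directed beta xi w -> O xi -> exists U : set (ends T),
  [/\ open U, U w & forall xi' w', directed beta xi' w' -> U w' -> O xi'].
Proof.
move=> [p] + h Oxi; rewrite boundary_openE => /(_ p xi Oxi)[r0 Hr0].
have [r wr] := ends_ex w; have rr := ends_ray wr.
have [n Hn] := side_behind_ball Xc td p (r0 + L) Xlf rr.
have {}Hn := Hn n (leqnn n); have rn := rr.2 n.
have rn' : adj (r n.+1) (r n) by rewrite adj_sym.
have wn : end_tails_in w (branch (r n.+1) (r n)).
  by apply/(end_tailsP Ttree wr rn'); exact: ray_ahead.
exists [set w' | end_tails_in w' (branch (r n.+1) (r n))]; split=> //.
  exact: ends_open_branch.
move=> xi' w' h' Uw'; apply: Hr0.
have [a xa a0] := boundary_ray_from Xc Xlf hyp xi p.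
have [b xb b0] := boundary_ray_from Xc Xlf hyp xi' p.
have cross c eta v : sval eta c -> c 0 = p -> directed beta eta v ->
    end_tails_in v (branch (r n.+1) (r n)) ->
    exists k, r0 + L <= k /\ adhesion beta (r n) (r n.+1) (c k).
  move=> ec c0 hv vn; have gc := boundary_geodesic ec.
  have [M HM] := hv _ _ rn' vn c ec.
  have [||k [h1 _ h2]] := geodesic_ray_crossing Xc td gc rn (leq_maxl (r0 + L) M).
  - by apply: Hn; rewrite -c0 gc // subn0.
  - exact: HM (leq_maxr _ _).
  by exists k.
have [i [hi Si]] := cross a xi w xa a0 h wn.
have [j [hj Sj]] := cross b xi' w' xb b0 h' Uw'.
apply: (boundary_nbhs_intro Xc xa xb a0 b0 (m := i) (n := j)).
by have := adhesion_diam rn Si Sj; lia.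
Qed.

Lemma sinks_closed t : open [set xi | ~ sinks beta xi t].
Proof.
rewrite boundary_openE => p xi nxit.
have [u [v [uv ut nuv]]] : exists u v,
    [/\ adj u v, branch u v t & ~ boundary_side beta u v xi].
  apply: contrapT => H; apply: nxit => u v uv ut; apply: contrapT => nuv.
  by apply: H; exists u, v.
have vu : adj v u by rewrite adj_sym.
have vuxi : boundary_side beta v u xi.
  by have [] := boundary_side_or Xc td adhesion_finite xi uv.
have [r Hr] := boundary_side_nbhs Xc td adhesion_finite p vu.
exists r => xi' /(Hr xi vuxi) h /(_ _ _ uv ut) h'.
exact: (boundary_side_excl td adhesion_finite uv h' h).
Qed.

(** If an adhesion set met the ball of radius [R], it would lie within [R + L] of [p]. As the ball
    of radius [R + L + 1] is behind the edge, no geodesic from [p] could leave it and get ahead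
    afterwards, so the side ahead would be finite. *)
Lemma ray_leaves_ball (r : nat -> T) (p : X) R :
  (forall u v, adj u v -> infinite_set (side beta u v)) -> ray r ->
  exists N, forall n, N <= n -> forall x, adhesion beta (r n) (r n.+1) x -> R <= dist p x.
Proof.
move=> inf rr; have [N HN] := side_behind_ball Xc td p (R + L + 1) Xlf rr.
exists N => n Nn x Sx; rewrite leqNgt; apply/negP => pxR; have rn := rr.2 n.
have rn' : adj (r n.+1) (r n) by rewrite adj_sym.
have near y : dist p y <= R + L + 1 -> side beta (r n) (r n.+1) y by exact: HN.
apply: (inf _ _ rn'); apply: sub_finite_set (finite_ball Xc Xlf p (R + L + 1)) => y fy.
rewrite /= leqNgt; apply/negP => py.
have [g [g0 gl sg]] := exists_segment Xc p y.
pose k := R + L + 1.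
have kl : k <= dist p y by exact: ltnW.
have [||m [km ml Sm]] := segment_crossing Xc td sg rn kl (leqnn _).
- by apply: near; rewrite -{1}g0 sg // subn0.
- by rewrite gl.
have := adhesion_diam rn Sx Sm; have := sg 0 m (leq0n _) ml; rewrite g0.
have := dist_triangle Xc x p (g m); have : k = R + L + 1 by []; lia.
Qed.

Lemma directed_total w : inhabited X ->
  (forall u v, adj u v -> infinite_set (side beta u v)) ->
  exists xi, directed beta xi w.
Proof.
move=> [p] inf; have [r wr] := ends_ex w; have rr := ends_ray wr.
(* Adhesion sets are nonempty: [X] is connected and both sides contain a nonempty bag. *)
have /choice[s Hs] n : exists x, adhesion beta (r n) (r n.+1) x.
  have rn := rr.2 n; have rn' : adj (r n.+1) (r n) by rewrite adj_sym.
  have nonempty t : exists x, beta t x.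
    by have [[q] _] := bags_connected t; exists (val q); have := valP q; rewrite inE.
  have [x hx] := nonempty (r n); have [y hy] := nonempty (r n.+1).
  have [z [hz _]] := dist_side_crossing Xc td rn
    (bag_side td rn (branch_self rn) hx) (bag_side td rn' (branch_self rn') hy).
  by exists z.
have /choice[g Hg] n := exists_segment Xc p (s n).
have [|||| a [ga a0 H]] := limit_ray Xc Xlf (c := g) (l := fun n => dist p (s n)) (p := p).
- by move=> n; have [] := Hg n.
- by move=> n; have [] := Hg n.
- by move=> n i li; have [_ h _] := Hg n; rewrite !h.
- by move=> M; have [N HN] := ray_leaves_ball p M inf rr; exists N => n /HN; apply.
exists (boundary_point ga) => u v uv wu.
apply/(boundary_sideP Xc td adhesion_finite uv (boundary_pointP ga)).
(* If the limit ray ran to the wrong side, a segment to a late [s n], which is on the side of [w],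
   would cross the adhesion set farther from [p] than any of its points. *)
have [//|[M HM]] := geodesic_tail_side Xc td adhesion_finite ga uv; exfalso.
have vu : adj v u by rewrite adj_sym.
have [N HN] := wu r wr.
have [B HB] := finite_ub (dist p) (adhesion_finite vu).
pose k := maxn M B.+1.
have [n Nn [kl ag]] := H k N.
have [g0 gl sg] := Hg n.
have [||m [km ml Sm]] := segment_crossing Xc td sg vu kl (leqnn _).
- by rewrite ag //; apply: HM; exact: leq_maxl.
- rewrite gl //; apply: (bag_side td uv (HN n Nn)); exact: (Hs n).1.
have := HB _ Sm; rewrite -{1}g0 sg // subn0.
by have := leq_maxr M B.+1; rewrite -/k; lia.
Qed.

End Bags.

(** * Borel relations *)

Section Borel.
Implicit Types Y Z W : topologicalType.

Definition borel Y : set (set Y) := <<s @open Y >>.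

Lemma borel_open Y (A : set Y) : open A -> borel A.
Proof. exact: sub_sigma_algebra. Qed.

Lemma borel0 Y : borel (@set0 Y).
Proof. exact: sigma_algebra0. Qed.

Lemma borelC Y (A : set Y) : borel A -> borel (~` A).
Proof. by move=> /sigma_algebraCD; rewrite setTD. Qed.

Lemma borel_bigcup Y (F : nat -> set Y) : (forall n, borel (F n)) ->
  borel (\bigcup_n F n).
Proof. exact: sigma_algebra_bigcup. Qed.

Lemma borel_bigcup_index Y (I : Type) (idx : I -> nat) (F : I -> set Y) :
  injective idx -> (forall i, borel (F i)) -> borel (\bigcup_i F i).
Proof.
move=> idxI bF; pose G n := [set y | exists2 i, idx i = n & F i y].
have -> : \bigcup_i F i = \bigcup_n G n.
  apply/seteqP; split=> y; first by move=> [i _ Fy]; exists (idx i) => //; exists i.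
  by move=> [n _ [i _ Fy]]; exists i.
apply: borel_bigcup => n; have [[i ei]|nn] := pselect (exists i, idx i = n).
  suff -> : G n = F i by [].
  apply/seteqP; split=> y; last by exists i.
  by move=> [j jn]; rewrite -ei in jn; rewrite (idxI _ _ jn).
have -> : G n = set0; last exact: borel0.
by apply/seteqP; split=> y // [i jn _]; apply: nn; exists i.
Qed.

Lemma borelU Y (A B : set Y) : borel A -> borel B -> borel (A `|` B).
Proof.
move=> bA bB; have -> : A `|` B = \bigcup_(b : bool) (if b then A else B).
  apply/seteqP; split=> y; first by case=> ?; [exists true|exists false].
  by move=> [[] _]; [left|right].
by apply: (@borel_bigcup_index _ _ nat_of_bool) => [[] []|[]].
Qed.

Lemma borelI Y (A B : set Y) : borel A -> borel B -> borel (A `&` B).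
Proof.
move=> bA bB; rewrite -[A `&` B]setCK setCI.
by apply: borelC; apply: borelU; exact: borelC.
Qed.

Lemma borel_ind Y (P : set Y -> Prop) : (forall A, open A -> P A) -> P set0 ->
  (forall A, P A -> P (~` A)) ->
  (forall F : nat -> set Y, (forall n, P (F n)) -> P (\bigcup_n F n)) ->
  forall A, borel A -> P A.
Proof.
move=> Po P0 PC PU A bA; apply: (bA P); split; last by move=> B; exact: Po.
by split=> // B PB; rewrite setTD; exact: PC.
Qed.

Lemma borel_preimage Y Z (f : Y -> Z) : continuous f ->
  forall A, borel A -> borel (f @^-1` A).
Proof.
move=> cf; apply: borel_ind => [A oA||A bA|F bF].
- by apply: borel_open; move/continuousP: cf; apply.
- by rewrite preimage_set0; exact: borel0.
- by rewrite preimage_setC; exact: borelC.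
- by rewrite preimage_bigcup; exact: borel_bigcup.
Qed.

(** Continuity on the domain of [m] in its subspace topology, without forming the subspace. *)
Definition partial_continuous Y Z (m : Y -> Z -> Prop) := forall (O : set Z) y z,
  open O -> m y z -> O z -> exists U : set Y,
    [/\ open U, U y & forall y' z', m y' z' -> U y' -> O z'].

(** Induction on Borel sets. The rectangle [D] of the two domains has to be Borel because
    complements are taken relative to it. *)
Lemma borel_partial_preimage Y Y' Z (m : Y -> Z -> Prop) (m' : Y' -> Z -> Prop) :
  (forall y z z', m y z -> m y z' -> z = z') ->
  (forall y z z', m' y z -> m' y z' -> z = z') ->
  borel [set y | exists z, m y z] -> borel [set y | exists z, m' y z] ->
  partial_continuous m -> partial_continuous m' ->
  forall A : set (Z * Z)%type, borel A ->
  borel [set p : (Y * Y')%type | exists z z', [/\ m p.1 z, m' p.2 z' & A (z, z')]].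
Proof.
move=> fm fm' bm bm' cm cm'.
pose D := [set p : (Y * Y')%type | (exists z, m p.1 z) /\ (exists z, m' p.2 z)].
have bD : borel D.
  apply: borelI.
    by apply: (borel_preimage (f := fst) _ bm) => p; exact: cvg_fst.
  by apply: (borel_preimage (f := snd) _ bm') => p; exact: cvg_snd.
apply: borel_ind => [A oA||A bA|F bF].
- pose R (UV : set Y * set Y') := forall y y' z z', m y z -> m' y' z' ->
    UV.1 y -> UV.2 y' -> A (z, z').
  (* This union may be uncountable, but it is open in the product and therefore Borel. *)
  pose O := \bigcup_(UV in [set UV | [/\ open UV.1, open UV.2 & R UV]]) (UV.1 `*` UV.2).
  have -> : [set p : (Y * Y')%type | exists z z', [/\ m p.1 z, m' p.2 z' & A (z, z')]]
      = D `&` O.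
    apply/seteqP; split=> [[y y'] /= [z [z' [yz yz' Az]]]|[y y']].
      split; first by split; [exists z|exists z'].
      have [[B B'] [nB nB'] BA] : nbhs (z, z') A by exact: open_nbhs_nbhs.
      move: nB nB'; rewrite !nbhsE => -[C [oC Cz] CB] [C' [oC' Cz'] CB'].
      have [U [oU Uy HU]] := cm C y z oC yz Cz.
      have [V [oV Vy HV]] := cm' C' y' z' oC' yz' Cz'.
      exists (U, V) => //; split=> // x x' w w' xw xw' Ux Vx.
      by apply: BA; split=> /=; [apply/CB/(HU _ _ xw)|apply/CB'/(HV _ _ xw')].
    move=> /= [[[z yz] [z' yz']] [[U V] [_ _ HR] [Uy Vy]]].
    by exists z, z'; split=> //; exact: HR yz yz' Uy Vy.
  apply: borelI => //; apply: borel_open; apply: bigcup_open => -[U V] [/= oU oV _].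
  rewrite openE => -[y y'] [Uy Vy]; exists (U, V) => //.
  by split; apply: open_nbhs_nbhs.
- have -> : [set p : (Y * Y')%type |
    exists z z', [/\ m p.1 z, m' p.2 z' & set0 (z, z')]] = set0.
    by apply/seteqP; split=> p // -[z [z' []]].
  exact: borel0.
- set B := [set p | _] in bA; set C := [set p | _].
  have -> : C = D `&` ~` B.
    apply/seteqP; split=> [[y y'] [z [z' /= [yz yz' nA]]]|[y y']].
      split; first by split; [exists z|exists z'].
      move=> [w [w' [yw yw' Aw]]]; apply: nA.
      by rewrite (fm _ _ _ yz yw) (fm' _ _ _ yz' yw').
    move=> [[[z yz] [z' yz']] nB]; exists z, z'; split=> // Az.
    by apply: nB; exists z, z'.
  by apply: borelI => //; exact: borelC.
- set C := [set p | _].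
  have -> : C = \bigcup_n [set p : (Y * Y')%type |
      exists z z', [/\ m p.1 z, m' p.2 z' & F n (z, z')]].
    apply/seteqP; split=> [p [z [z' [yz yz' [n _ Fn]]]]|p [n _ [z [z' [yz yz' Fn]]]]].
      by exists n => //; exists z, z'.
    by exists z, z'; split=> //; exists n.
  exact: borel_bigcup.
Qed.

End Borel.

Lemma finite_partial_preimage (Y Z : Type) (m : Y -> Z -> Prop) (C : set Z) :
  (forall y y' z, m y z -> m y' z -> y = y') -> finite_set C ->
  finite_set [set y | exists2 z, C z & m y z].
Proof.
move=> im fC; have -> : [set y | exists2 z, C z & m y z] =
    \bigcup_(z in C) [set y | m y z].
  by apply/seteqP; split=> y [z Cz yz]; exists z.
apply: bigcup_finite => // z _.
have [[y0 y0z]|n] := pselect (exists y, m y z).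
  apply: (@sub_finite_set _ _ [set y0]); last exact: finite_set1.
  by move=> y yz; exact: im yz y0z.
by apply: (@sub_finite_set _ _ set0) => // y yz; apply: n; exists y.
Qed.

(* The piece [i] of [Y] is embedded into the space [Z k] by the graph [m i k] of a
   partial function.  A point of a piece not yet reached at stage [n] is only
   related within that piece: the classes stay finite, and reflexivity does not
   require the diagonal of [Y] to be Borel. *)
Lemma borel_hyperfinite_pieces (Y : topologicalType) (I K : Type)
    (Z : K -> topologicalType) (E : Y -> Y -> Prop)
    (EZ : forall k, Z k -> Z k -> Prop)
    (m : I -> forall k, Y -> Z k -> Prop) (idx : I -> nat) :
  injective idx ->
  (forall y, exists i k z, m i k y z) ->
  (forall i i' k k' y z z', m i k y z -> m i' k' y z' -> i = i') ->
  (forall i k k' y y' z z', m i k y z -> m i k' y' z' -> k = k') ->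
  (forall i k y z z', m i k y z -> m i k y z' -> z = z') ->
  (forall i k y y' z, m i k y z -> m i k y' z -> y = y') ->
  (forall i k, borel [set y | exists z, m i k y z]) ->
  (forall i k, partial_continuous (m i k)) ->
  (forall i j k k' y y' z z', m i k y z -> m j k' y' z' -> E y y' -> k = k') ->
  (forall i j k y y' z z', m i k y z -> m j k y' z' -> (E y y' <-> EZ k z z')) ->
  (forall k, borel_hyperfinite (EZ k)) ->
  borel_hyperfinite E.
Proof.
move=> idxI tot piece index func inj bdom cont rel1 rel2 hyp.
have {hyp}[F hF] : exists F : forall k, nat -> Z k -> Z k -> Prop, forall k,
    [/\ forall n, finite_borel_equivalence (F k n),
        forall n y z, F k n y z -> F k n.+1 y z
      & forall y z, EZ k y z <-> exists n, F k n y z].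
  exists (fun k => sval (cid (hyp k))) => k; exact: svalP (cid (hyp k)).
have Fle k n n' z z' : n <= n' -> F k n z z' -> F k n' z z'.
  have [_ Fs _] := hF k; move=> nn' Fn; rewrite -(subnK nn').
  by elim: (n' - n) => // d IH; rewrite addSn; exact: Fs.
pose near n i j := i = j \/ idx i <= n /\ idx j <= n.
pose F' n y y' := exists i j k z z',
  [/\ near n i j, m i k y z, m j k y' z' & F k n z z'].
exists F'; split.
- move=> n; split.
  + split.
    * move=> y; have [i [k [z yz]]] := tot y; exists i, i, k, z, z; split=> //.
        by left.
      by have [/(_ n)[[R _ _] _ _] _ _] := hF k; exact: R.
    * move=> y y' [i [j [k [z [z' [nij yz yz' Fz]]]]]]; exists j, i, k, z', z.
      split=> //; first by case: nij => [->|[]]; [left|right].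
      by have [/(_ n)[[_ S _] _ _] _ _] := hF k; exact: S.
    * move=> y y' y'' [i [j [k [z [z' [nij yz yz' Fz]]]]]].
      move=> [i' [j' [k' [w [w' [nij' yw yw' Fw]]]]]].
      have ji := piece _ _ _ _ _ _ _ yz' yw; subst i'.
      have kk := index _ _ _ _ _ _ _ yz' yw; subst k'.
      have zw := func _ _ _ _ _ yz' yw; subst w.
      exists i, j', k, z, w'; split=> //.
        case: nij nij' => [->//|[h1 h2]] [<-|[h3 h4]]; by right.
      have [/(_ n)[[_ _ Tr] _ _] _ _] := hF k; exact: Tr Fz Fw.
  + pose P i j := [set p : (Y * Y)%type | near n i j /\
      exists k z z', [/\ m i k p.1 z, m j k p.2 z' & F k n z z']].
    rewrite /borel_relation -/(borel _).
    have -> : [set p | F' n p.1 p.2] = \bigcup_i \bigcup_j P i j.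
      apply/seteqP; split=> p.
        move=> [i [j [k [z [z' [nij yz yz' Fz]]]]]].
        by exists i => //; exists j => //; split => //; exists k, z, z'.
      move=> [i _ [j _ [nij [k [z [z' [yz yz' Fz]]]]]]].
      by exists i, j, k, z, z'; split.
    apply: (borel_bigcup_index idxI) => i; apply: (borel_bigcup_index idxI) => j.
    (* A nonempty block singles out one target [k], since a piece determines its target; the block
       is then the preimage of a single Borel relation. *)
    have [[p [nij [k [z0 [z0' [yz0 yz0' _]]]]]]|none] := pselect (P i j !=set0).
      have -> : P i j = [set p : (Y * Y)%type | exists z z',
          [/\ m i k p.1 z, m j k p.2 z' & [set q | F k n q.1 q.2] (z, z')]].
        apply/seteqP; split=> q.
          move=> [_ [k' [z [z' [yz yz' Fz]]]]].
          have kk := index _ _ _ _ _ _ _ yz yz0; subst k'.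
          by exists z, z'.
        by move=> [z [z' [yz yz' Fz]]]; split=> //; exists k, z, z'.
      apply: borel_partial_preimage => //; try by [exact: func|exact: cont].
      by have [/(_ n)[]] := hF k.
    have -> : P i j = set0; last exact: borel0.
    by apply/seteqP; split=> // p Pp; apply: none; exists p.
  + move=> y; have [i [k [z yz]]] := tot y.
    (* Only finitely many pieces are joined to [i] at stage [n], and by injectivity each of them
       contributes the preimage of a finite class. *)
    apply: (@sub_finite_set _ _ (\bigcup_(j in [set j | near n i j])
        [set y' | exists2 z', [set z' | F k n z z'] z' & m j k y' z'])).
      move=> y' [i' [j [k' [w [w' [nij yw yw' Fw]]]]]].
      have ii := piece _ _ _ _ _ _ _ yz yw; subst i'.
      have kk := index _ _ _ _ _ _ _ yz yw; subst k'.
      have zw := func _ _ _ _ _ yz yw; subst w.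
      by exists j => //; exists w'.
    apply: bigcup_finite.
      apply: (@sub_finite_set _ _ ([set i] `|` idx @^-1` `I_n.+1)).
        by move=> j [->|[_ jn]]; [left|right].
      rewrite finite_setU; split; first exact: finite_set1.
      by apply: finite_preimage => [? ? _ _ /idxI|]; last exact: finite_II.
    move=> j _; apply: finite_partial_preimage; first exact: inj.
    by have [/(_ n)[]] := hF k.
- move=> n y y' [i [j [k [z [z' [nij yz yz' Fz]]]]]]; exists i, j, k, z, z'.
  split=> //; first by case: nij => [->|[h1 h2]]; [left|right; lia].
  by have [_ Fs _] := hF k; exact: Fs.
- move=> y y'; split.
    have [i [k [z yz]]] := tot y; have [j [k' [z' yz']]] := tot y'.
    move=> Ey; have kk := rel1 _ _ _ _ _ _ _ _ yz yz' Ey; subst k'.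
    have [_ _ HE] := hF k.
    have [N FN] := (HE _ _).1 ((rel2 _ _ _ _ _ _ _ yz yz').1 Ey).
    exists (maxn N (maxn (idx i) (idx j))), i, j, k, z, z'; split=> //.
      by right; lia.
    by apply: Fle FN; lia.
  move=> [n [i [j [k [z [z' [_ yz yz' Fz]]]]]]].
  apply/(rel2 _ _ _ _ _ _ _ yz yz'); have [_ _ HE] := hF k.
  by apply/HE; exists n.
Qed.

(** * The group action *)

Section BoundaryAction.
Variable X : graph.
Hypothesis Xc : forall x y : X, reach x y.
Implicit Types (g h : aut X) (xi : boundary X).

Lemma boundary_act_mem g xi a : sval xi a -> sval (boundary_act g xi) (g \o a).
Proof. by move=> xa; exists a. Qed.

Lemma boundary_actM g h xi :
  boundary_act (g * h)%g xi = boundary_act g (boundary_act h xi).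
Proof.
have [a xa] := boundary_ex xi.
apply: (boundary_eq Xc (a := g \o (h \o a)) (b := g \o (h \o a))).
- exact: (boundary_act_mem (g * h)%g xa).
- by do 2!apply: boundary_act_mem.
- exact: finite_hausdorff_refl.
Qed.

Lemma boundary_act1 xi : boundary_act 1%g xi = xi.
Proof.
have [a xa] := boundary_ex xi; apply: (boundary_eq Xc (a := a) (b := a)) => //.
  exact: (boundary_act_mem 1%g xa).
exact: finite_hausdorff_refl.
Qed.

Lemma boundary_actK g : cancel (boundary_act g) (boundary_act g^-1%g).
Proof. by move=> xi; rewrite -boundary_actM mulVg boundary_act1. Qed.

Lemma boundary_act_open g (O : set (boundary X)) : open O ->
  open (boundary_act g @^-1` O).
Proof.
rewrite !boundary_openE => oO p xi /(oO (g p))[r Hr].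
exists r => eta [a [b [xa eb a0 b0 [N HN]]]]; apply: Hr.
exists (g \o a), (g \o b); split=> /=.
- exact: boundary_act_mem.
- exact: boundary_act_mem.
- by rewrite a0.
- by rewrite b0.
- by exists N => n /HN; rewrite /gromov_product !aut_dist.
Qed.

Lemma path_within_aut g A x y n : path_within A x y n ->
  path_within (g @` A) (g x) (g y) n.
Proof.
move=> [s [ps ls sn sA]]; exists (map g s); split.
- by rewrite aut_path.
- by rewrite last_map ls.
- by rewrite size_map.
- by move=> z; rewrite -map_cons => /mapP[w /sA Aw ->]; exists w.
Qed.

End BoundaryAction.

Section Action.
Variables (X T : graph) (G : set (aut X)) (beta : T -> set X).
Variable actT : aut X -> aut T.
Hypothesis Xc : forall x y : X, reach x y.
Hypothesis G_group : group_closed [in G].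
Hypothesis td : tree_decomposition beta.
Hypothesis invariant : invariant_decomposition beta G actT.
Hypothesis adhesion_finite : forall u v, adj u v -> finite_set (adhesion beta u v).
Implicit Types (g h : aut X) (xi : boundary X) (w : ends T) (s t u v : T).

Let Ttree : is_tree T. Proof. by case: td. Qed.

Lemma G_one : G 1%g.
Proof. by have [] := G_group; rewrite inE. Qed.

Lemma G_inv g : G g -> G g^-1%g.
Proof.
move=> Gg; have Gg' : g \in [in G] by rewrite inE.
by have := group_closedV G_group Gg'; rewrite inE.
Qed.

Lemma G_mul g h : G g -> G h -> G (g * h)%g.
Proof.
move=> Gg Gh; have Gg' : g \in [in G] by rewrite inE.
have Gh' : h \in [in G] by rewrite inE.
by have := group_closedM G_group Gg' Gh'; rewrite inE.
Qed.

Lemma actT1 t : actT 1%g t = t.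
Proof.
have [aM _] := invariant; apply: (can_inj (aut_funK (actT 1%g))).
rewrite -[LHS]/((actT 1%g * actT 1%g)%g t).
by rewrite -(aM _ _ G_one G_one) mulg1.
Qed.

Lemma actTM g h t : G g -> G h -> actT (g * h)%g t = actT g (actT h t).
Proof. by have [aM _] := invariant => Gg Gh; rewrite aM. Qed.

Lemma actTK g t : G g -> actT g^-1%g (actT g t) = t.
Proof. by move=> Gg; rewrite -actTM ?mulVg ?actT1 //; exact: G_inv. Qed.

Lemma bag_act g t : G g -> beta (actT g t) = g @` beta t.
Proof. by have [_ bM] := invariant => Gg; exact: bM. Qed.

Lemma adhesion_act g u v : G g ->
  adhesion beta (actT g u) (actT g v) = g @` adhesion beta u v.
Proof.
move=> Gg; rewrite /adhesion !bag_act //; apply/seteqP; split=> x.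
  move=> [[y uy <-] [z vz]] /(can_inj (aut_funK g)) zy.
  by exists y => //; split=> //; rewrite -zy.
by move=> [y [uy vy] <-]; split; exists y.
Qed.

Lemma branch_aut (k : aut T) u v s : branch u v s -> branch (k u) (k v) (k s).
Proof. by move=> /(aut_component k); rewrite image_set1. Qed.

Lemma branch_autE (k : aut T) u v s : branch (k u) (k v) (k s) <-> branch u v s.
Proof.
split; last exact: branch_aut.
by move=> /(branch_aut (aut_V k)); rewrite /= !aut_funK.
Qed.

Lemma side_act g u v x : G g -> adj u v -> side beta u v x ->
  side beta (actT g u) (actT g v) (g x).
Proof.
move=> Gg uv; rewrite !(side_branch td) ?aut_adj // => -[s us sx].
exists (actT g s); first exact: branch_aut.
by rewrite bag_act //; exists x.
Qed.

Lemma boundary_side_act g u v xi : G g -> adj u v -> boundary_side beta u v xi ->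
  boundary_side beta (actT g u) (actT g v) (boundary_act g xi).
Proof.
move=> Gg uv h; have [a xa] := boundary_ex xi.
have uv' : adj (actT g u) (actT g v) by rewrite aut_adj.
apply/(boundary_sideP Xc td adhesion_finite uv' (boundary_act_mem g xa)).
by have [N HN] := h a xa; exists N => n /HN; exact: side_act.
Qed.

Lemma sinks_act g t xi : G g -> sinks beta xi t ->
  sinks beta (boundary_act g xi) (actT g t).
Proof.
move=> Gg h u v; rewrite -(aut_invK (actT g) u) -(aut_invK (actT g) v) aut_adj.
by move=> uv /branch_autE ut; apply: boundary_side_act => //; exact: h.
Qed.

Lemma sinks_actE g t xi : G g ->
  sinks beta (boundary_act g xi) (actT g t) <-> sinks beta xi t.
Proof.
move=> Gg; split; last exact: sinks_act.
by move=> /(sinks_act (G_inv Gg)); rewrite boundary_actK // actTK.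
Qed.

Lemma directed_act g xi w : G g -> directed beta xi w ->
  directed beta (boundary_act g xi) (ends_act (actT g) w).
Proof.
move=> Gg h u v; rewrite -(aut_invK (actT g) u) -(aut_invK (actT g) v) aut_adj.
move=> uv wuv; apply: boundary_side_act => //; apply: h => // r wr.
have [|N HN] := wuv (actT g \o r); first by exists r.
by exists N => n /HN /branch_autE.
Qed.

Lemma E_boundary_sym xi eta : E_boundary G xi eta -> E_boundary G eta xi.
Proof.
by move=> [g Gg <-]; exists g^-1%g; [exact: G_inv|rewrite boundary_actK].
Qed.

Lemma E_boundary_trans eta xi zeta :
  E_boundary G xi eta -> E_boundary G eta zeta -> E_boundary G xi zeta.
Proof.
move=> [g Gg <-] [h Gh <-]; exists (h * g)%g; first exact: G_mul.
by rewrite boundary_actM.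
Qed.

Lemma E_boundary_act g h xi eta : G g -> G h ->
  E_boundary G (boundary_act g xi) (boundary_act h eta) <-> E_boundary G xi eta.
Proof.
move=> Gg Gh.
have e1 : E_boundary G xi (boundary_act g xi) by exists g.
have e2 : E_boundary G eta (boundary_act h eta) by exists h.
split=> H.
  apply: (E_boundary_trans e1); apply: (E_boundary_trans H).
  exact: E_boundary_sym.
exact: E_boundary_trans (E_boundary_trans (E_boundary_sym e1) H) e2.
Qed.

Hypothesis edges_cofinite : finite_set (edge_orbits G actT).

Lemma edge_orbit_mem u v : adj u v ->
  exists2 O, edge_orbits G actT O & O [set u; v].
Proof.
move=> uv; exists [set actT g @` [set u; v] | g in G].
  by exists [set u; v] => //; exists u, v.
exists 1%g; first exact: G_one.
by rewrite image_setU !image_set1 !actT1.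
Qed.

Hypothesis bags_connected : forall t, connected_graph (induced (beta t)).

Lemma adhesion_path_edge u v : adj u v -> exists N, forall n, N <= n -> forall x y,
  adhesion beta u v x -> adhesion beta u v y -> path_within (beta u) x y n.
Proof.
move=> uv; have fS := adhesion_finite uv.
suff [N HN] : exists N, forall n, N <= n -> forall x, adhesion beta u v x ->
    forall y, adhesion beta u v y -> path_within (beta u) x y n.
  by exists N => n /HN H x y Sx Sy; exact: H.
apply: finite_eventually => // x Sx; apply: finite_eventually => // y Sy.
have [m Hm] := path_within_ex (bags_connected u) Sx.1 Sy.1.
by exists m => n mn; exact: path_within_leq mn Hm.
Qed.

(** [G] carries bags to bags and adhesion sets to adhesion sets, so one edge from each of the
    finitely many orbits decides the bound. *)
Lemma adhesion_path_bound : exists L, forall u v, adj u v -> forall x y,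
  adhesion beta u v x -> adhesion beta u v y -> path_within (beta u) x y L.
Proof.
suff [L HL] : exists L, forall n, L <= n -> forall O, edge_orbits G actT O ->
    forall u v, O [set u; v] -> forall x y,
    adhesion beta u v x -> adhesion beta u v y -> path_within (beta u) x y n.
  exists L => u v /edge_orbit_mem[O oO Ouv]; exact: HL Ouv.
apply: finite_eventually => // O [e [u0 [v0 [uv0 ->]]] <-].
(* Orbits consist of unordered edges, whereas the path has to stay in the bag of the first endpoint;
   both orientations are bounded. *)
have vu0 : adj v0 u0 by rewrite adj_sym.
have [N HN] := adhesion_path_edge uv0; have [M HM] := adhesion_path_edge vu0.
exists (maxn N M) => n; rewrite geq_max => /andP[/HN {}HN /HM {}HM].
have main u v g : G g -> (forall x y, adhesion beta u v x -> adhesion beta u v y ->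
     path_within (beta u) x y n) -> forall x y, adhesion beta (actT g u) (actT g v) x ->
     adhesion beta (actT g u) (actT g v) y -> path_within (beta (actT g u)) x y n.
  move=> Gg H x y; rewrite adhesion_act // bag_act // => -[x' Sx <-] [y' Sy <-].
  by apply: path_within_aut; exact: H.
move=> u v [g Gg]; rewrite image_setU !image_set1 => eS.
have g0 : actT g u0 <> actT g v0.
  by move=> /(can_inj (aut_funK (actT g))) h; apply: (adj_neq uv0).
have : [set u; v] (actT g u0) by rewrite -eS; left.
have : [set u; v] (actT g v0) by rewrite -eS; right.
move=> [|] e1 [|] e2; try by case: g0; rewrite e1 e2.
  by rewrite -e1 -e2; exact: main.
by rewrite -e1 -e2; exact: main.
Qed.

End Action.

(** * Hyperfiniteness *)

Section Main.
Variables (X T : graph) (G : set (aut X)) (beta : T -> set X).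
Variable actT : aut X -> aut T.
Hypothesis X_connected : connected_graph X.
Hypothesis Xlf : locally_finite X.
Variable D : nat.
Hypothesis hyp : four_point X D.
Hypothesis G_group : group_closed [in G].
Hypothesis G_countable : countable G.
Hypothesis td : tree_decomposition beta.
Hypothesis invariant : invariant_decomposition beta G actT.
Hypothesis bags_connected : forall t, connected_graph (induced (beta t)).
Hypothesis adhesion_finite : forall u v, adj u v -> finite_set (adhesion beta u v).
Hypothesis edges_cofinite : finite_set (edge_orbits G actT).

Let Xc : forall x y : X, reach x y. Proof. by case: X_connected. Qed.
Let Ttree : is_tree T. Proof. by case: td. Qed.

Lemma tree_countable : countable [set: T].
Proof.
have [[[t0] _] _] := Ttree.
have cE : countable (@edges T).
  apply: (@sub_countable _ _ _ (\bigcup_(O in edge_orbits G actT) O)).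
    apply: subset_card_le => e [u [v [uv ->]]].
    have [O oO Oe] := edge_orbit_mem G_group invariant uv.
    by exists O.
  apply: bigcup_countable; first exact: finite_set_countable.
  move=> O [e _ <-]; apply: sub_countable G_countable.
  exact: card_image_le.
apply: (@sub_countable _ _ _ ([set t0] `|` \bigcup_(e in @edges T) e)).
  apply: subset_card_le => t _.
  have [->|tt0] := pselect (t = t0); [by left|right].
  have [s ts _] := toward_neighbour Ttree tt0.
  by exists [set t; s]; [exists t, s|left].
have -> : [set t0] `|` \bigcup_(e in @edges T) e =
    \bigcup_(e in [set [set t0]] `|` @edges T) e.
  by rewrite bigcup_setU bigcup_set1.
apply: bigcup_countable.
  have -> : [set [set t0]] `|` @edges T =
      \bigcup_(b : bool) (if b then [set [set t0]] else @edges T).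
    apply/seteqP; split=> e; first by case=> ?; [exists true|exists false].
    by move=> [[] _]; [left|right].
  by apply: bigcup_countable => [|[] _]; [exact: countableP|exact: countable1|].
move=> e [->|[u [v [_ ->]]]]; first exact: countable1.
by apply: finite_set_countable; rewrite finite_setU; split; exact: finite_set1.
Qed.

Section Bound.
Variable L : nat.
Hypothesis adhesion_path : forall u v, adj u v -> forall x y,
  adhesion beta u v x -> adhesion beta u v y -> path_within (beta u) x y L.
Variable K : nat.
Hypothesis morse : forall (c : nat -> X) n (g : nat -> X) l,
  quasi_geodesic L.+1 c n -> segment g l -> g 0 = c 0 -> g l = c n ->
  (forall s, s <= l -> exists2 i, i <= n & dist (g s) (c i) <= K) /\
  (forall i, i <= n -> exists2 s, s <= l & dist (g s) (c i) <= K).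

Lemma induced_autE g t (x : induced (beta t)) : stabilizer G actT t g ->
  val (induced_aut (beta t) g x) = g (val x).
Proof.
move=> [Gg gt]; have e : g @` beta t = beta t.
  by rewrite -(bag_act invariant t Gg) gt.
by rewrite /induced_aut; case: pselect.
Qed.

Lemma bag_rel_act g t xi (zeta : boundary (induced (beta t))) :
  stabilizer G actT t g -> bag_rel xi zeta ->
  bag_rel (boundary_act g xi) (boundary_act (induced_aut (beta t) g) zeta).
Proof.
move=> gt [a [c [xa zc ac]]].
exists (g \o a), (induced_aut (beta t) g \o c); split.
- exact: boundary_act_mem.
- exact: boundary_act_mem.
- have := aut_hausdorff g ac; congr (finite_hausdorff _ _).
  by apply/funext => n; rewrite /bag_seq /= induced_autE.
Qed.

Let bag_rel_inj := bag_rel_injective Xc td bags_connected adhesion_path.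
Let bag_rel_fun := bag_rel_functional Xc td bags_connected adhesion_path.
Let bag_sinks := @bag_rel_sinks X T beta Xc td adhesion_finite.

(** An element of [G] that carries [xi] to [xi'] carries the sink of [xi] to that of [xi']; both are
    [t], so the element lies in the stabilizer. *)
Lemma E_bag_boundary t xi xi' (zeta zeta' : boundary (induced (beta t))) :
  bag_rel xi zeta -> bag_rel xi' zeta' ->
  E_boundary G xi xi' <-> E_bag G actT zeta zeta'.
Proof.
move=> xz xz'; split=> -[g].
  move=> Gg gx; have gt : stabilizer G actT t g.
    split=> //; have := sinks_act Xc td invariant adhesion_finite Gg (bag_sinks xz).
    by rewrite gx => /(sinks_unique td adhesion_finite); apply; exact: bag_sinks xz'.
  exists g => //; have := bag_rel_act gt xz; rewrite gx => h.
  exact: bag_rel_fun h xz'.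
move=> gt gz; exists g; first exact: gt.1.
by have := bag_rel_act gt xz; rewrite gz => h; exact: bag_rel_inj h xz'.
Qed.

Lemma E_tree_boundary xi xi' w w' : directed beta xi w -> directed beta xi' w' ->
  E_boundary G xi xi' <-> E_tree G actT w w'.
Proof.
move=> xw xw'; split=> -[g Gg gx]; exists g => //.
  have := directed_act Xc td invariant adhesion_finite Gg xw; rewrite gx => h.
  exact: directed_functional h xw'.
have := directed_act Xc td invariant adhesion_finite Gg xw; rewrite gx => h.
by apply: directed_injective h xw'; eassumption.
Qed.

(** The case of one piece: hyperfiniteness is pulled back along the continuous embedding of the bag
    boundary, which reduces one orbit relation to the other. *)
Lemma E_bag_hyperfinite t : borel_hyperfinite (E_boundary G) ->
  borel_hyperfinite (@E_bag X T beta G actT t).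
Proof.
move=> hE; pose m (_ _ : unit) (zeta : boundary (induced (beta t))) xi := bag_rel xi zeta.
apply: (@borel_hyperfinite_pieces _ unit unit (fun=> boundary X) _
  (fun=> E_boundary G) m (fun=> 0)) => //.
- by move=> [] [].
- move=> zeta; have [xi xz] := bag_rel_total Xc Xlf td bags_connected adhesion_path morse zeta.
  by exists tt, tt, xi.
- by move=> [] [].
- by move=> ? [] [].
- by move=> ? ? zeta xi xi' h h'; exact: bag_rel_inj h h'.
- by move=> ? ? zeta zeta' xi h h'; exact: bag_rel_fun h h'.
- move=> [] []; suff -> : [set zeta | exists xi, m tt tt zeta xi] = setT.
    by rewrite -setC0; apply: borelC; exact: borel0.
  apply/seteqP; split=> // zeta _.
  exact: (bag_rel_total Xc Xlf td bags_connected adhesion_path morse zeta).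
- move=> ? ? O zeta xi oO xz Oxi.
  exists [set zeta | forall xi, bag_rel xi zeta -> O xi]; split.
  + by apply: bag_rel_open_boundary; eassumption.
  + by move=> xi' xz'; rewrite (bag_rel_inj xz' xz).
  + by move=> zeta' xi' xz' /(_ _ xz').
- by move=> ? ? [] [].
- move=> ? ? ? zeta zeta' xi xi' xz xz'; exact: iff_sym (E_bag_boundary xz xz').
Qed.

Lemma E_tree_hyperfinite :
  (forall u v, adj u v -> infinite_set (side beta u v)) ->
  borel_hyperfinite (E_boundary G) -> borel_hyperfinite (E_tree G actT).
Proof.
move=> inf hE; have [inhX _] := X_connected.
have tot w : exists xi, directed beta xi w.
  exact: (directed_total Xc Xlf td bags_connected adhesion_finite adhesion_path w inhX inf).
have dinj := directed_injective Xc hyp td adhesion_path.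
pose m (_ _ : unit) w xi := directed beta xi w.
apply: (@borel_hyperfinite_pieces _ unit unit (fun=> boundary X) _
  (fun=> E_boundary G) m (fun=> 0)) => //.
- by move=> [] [].
- by move=> w; have [xi xw] := tot w; exists tt, tt, xi.
- by move=> [] [].
- by move=> ? [] [].
- by move=> ? ? w xi xi' h h'; exact: dinj h h'.
- by move=> ? ? w w' xi h h'; apply: directed_functional h h'.
- move=> [] []; suff -> : [set w | exists xi, m tt tt w xi] = setT.
    by rewrite -setC0; apply: borelC; exact: borel0.
  by apply/seteqP; split=> // w _; exact: tot.
- move=> ? ? O w xi oO xw Oxi.
  have [U [oU Uw HU]] := directed_open_boundary Xc Xlf hyp td adhesion_path inhX oO xw Oxi.
  by exists U; split=> // w' xi' h Uw'; exact: HU h Uw'.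
- by move=> ? ? [] [].
- move=> ? ? ? w w' xi xi' xw xw'; exact: iff_sym (E_tree_boundary xw xw').
Qed.

Definition piece_space (k : option T) : topologicalType :=
  if k is Some s then boundary (induced (beta s)) : topologicalType
  else ends T : topologicalType.

Definition piece_rel (k : option T) : piece_space k -> piece_space k -> Prop :=
  match k with
  | Some s => @E_bag X T beta G actT s
  | None => E_tree G actT
  end.

(** Points resting at different vertices of an orbit can be related, so all of them are compared in
    the bag of [rep t], where [tr t] transports them. *)
Lemma orbit_representatives : exists (rep : T -> T) (tr : T -> aut X),
  (forall t, G (tr t) /\ actT (tr t) t = rep t) /\
  (forall g t, G g -> rep (actT g t) = rep t).
Proof.
have [[[t0] _] _] := Ttree.
have /choice[f Hf] : forall A : set T, exists s, A !=set0 -> A s.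
  by move=> A; have [[s As]|nA] := pselect (A !=set0); [exists s|exists t0].
pose orb t := [set s | exists2 g, G g & actT g t = s].
have /choice[tr Htr] : forall t, exists g, G g /\ actT g t = f (orb t).
  move=> t; have [|g Gg gt] := Hf (orb t); last by exists g.
  by exists (actT 1%g t), 1%g => //; exact: G_one.
exists (f \o orb), tr; split=> // g t Gg /=; congr f.
apply/seteqP; split=> s [h Gh <-].
  by exists (h * g)%g; [exact: G_mul|rewrite (actTM invariant)].
exists (h * g^-1)%g; first by apply: G_mul => //; exact: G_inv.
rewrite (actTM invariant) //; last exact: G_inv.
by rewrite (actTK G_group invariant).
Qed.

Lemma E_boundary_hyperfinite : borel_hyperfinite (E_tree G actT) ->
  (forall t, borel_hyperfinite (@E_bag X T beta G actT t)) ->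
  borel_hyperfinite (E_boundary G).
Proof.
move=> hT hB; have [rep [tr [Htr Hrep]]] := orbit_representatives.
have /countable_injP[f0 f0I] := tree_countable.
have f0inj : injective f0 by move=> s t; apply: f0I; rewrite inE.
(* Index [0] is reserved for the piece of points directed to ends of [T]. *)
pose idx (i : option T) := if i is Some t then (f0 t).+1 else 0.
pose m (i k : option T) : boundary X -> piece_space k -> Prop :=
  match k return boundary X -> piece_space k -> Prop with
  | Some s => fun xi zeta => exists t,
      [/\ i = Some t, rep t = s & bag_rel (boundary_act (tr t) xi) zeta]
  | None => fun xi w => i = None /\ directed beta xi w
  end.
have sinkE t xi : sinks beta (boundary_act (tr t) xi) (rep t) <-> sinks beta xi t.
  have [Gt <-] := Htr t.
  exact: (sinks_actE Xc G_group td invariant adhesion_finite).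
have msink t k xi z : m (Some t) k xi z -> sinks beta xi t.
  case: k z => [s|] z /=; last by move=> [].
  by move=> [_ [[<-] e h]]; subst s; exact/sinkE/(bag_sinks h).
have mdir k xi z : m None k xi z -> exists w, directed beta xi w.
  by case: k z => [s|] z /=; [move=> [? []]|move=> [_ xw]; exists z].
have dinj := directed_injective Xc hyp td adhesion_path.
have sdisj := @sinks_not_directed X T beta td adhesion_finite.
have suniq := @sinks_unique X T beta td adhesion_finite.
apply: (@borel_hyperfinite_pieces _ _ _ piece_space _ piece_rel m idx).
- by case=> [s|] [t|] //= [/f0inj->].
- move=> xi; have [[t xit]|[w xw]] := sinks_or_directed Xc td adhesion_finite xi.
    have [zeta xz] := sinks_bag_rel Xc Xlf hyp td bags_connected
      adhesion_path morse ((sinkE t xi).2 xit).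
    by exists (Some t), (Some (rep t)), zeta, t.
  by exists None, None, w.
- move=> [t|] [t'|] k k' xi z z'.
  + by move=> /msink h /msink h'; rewrite (suniq _ _ _ h h').
  + by move=> /msink h /mdir[w h']; case: (sdisj _ _ _ h h').
  + by move=> /mdir[w h'] /msink h; case: (sdisj _ _ _ h h').
  + by [].
- move=> i [s|] [s'|] xi xi' z z' //=.
  + by move=> [t [-> e _]] [t' [[<-] e' _]]; rewrite -e -e'.
  + by move=> [t [-> _ _]] [].
  + by move=> [-> _] [t' []].
- move=> i [s|] xi z z' /=.
    move=> [t [-> _ h]] [t' [[<-] _ h']]; exact: bag_rel_fun h h'.
  by move=> [_ h] [_ h']; apply: directed_functional h h'.
- move=> i [s|] xi xi' z /=.
    move=> [t [-> _ h]] [t' [[<-] _ h']].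
    exact: (can_inj (boundary_actK Xc (tr t))) (bag_rel_inj h h').
  by move=> [_ h] [_ h']; exact: dinj h h'.
(* The points resting at a given vertex form a closed set; those directed to ends are the complement
   of a countable union of such sets. *)
- have bsink t : borel [set xi | sinks beta xi t].
    rewrite -[[set xi | _]]setCK; apply: borelC; apply: borel_open.
    exact: sinks_closed.
  have bnone (A : set (boundary X)) : (forall xi, ~ A xi) -> borel A.
    by move=> nA; suff -> : A = set0; [exact: borel0|apply/seteqP; split].
  case=> [t|] [s|].
  + have [ts|nts] := pselect (rep t = s); last first.
      by apply: bnone => xi [z [t' [[<-]]]].
    subst s; suff -> : [set xi | exists z, m (Some t) (Some (rep t)) xi z] =
        [set xi | sinks beta xi t] by [].
    apply/seteqP; split=> xi; first by move=> [z]; exact: msink.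
    move=> /sinkE h; have [zeta xz] := sinks_bag_rel Xc Xlf hyp td bags_connected
      adhesion_path morse h.
    by exists zeta, t.
  + by apply: bnone => xi [z []].
  + by apply: bnone => xi [z [t []]].
  + have -> : [set xi | exists z, m None None xi z] =
        ~` \bigcup_t [set xi | sinks beta xi t].
      apply/seteqP; split=> xi.
        by move=> [w [_ xw]] [t _ xit]; exact: sdisj xit xw.
      move=> ns; have [[t xit]|[w xw]] := sinks_or_directed Xc td adhesion_finite xi.
        by case: ns; exists t.
      by exists w.
    by apply: borelC; exact: borel_bigcup_index f0inj bsink.
- move=> i [s|] O xi z oO /=.
    move=> [t [-> ts h]] Oz.
    pose U := [set eta | forall zeta : boundary (induced (beta s)), bag_rel eta zeta -> O zeta].
    exists (boundary_act (tr t) @^-1` U); split.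
    + by apply: boundary_act_open; apply: bag_rel_open_bag; eassumption.
    + by move=> z' h'; rewrite (bag_rel_fun h' h).
    + by move=> xi' z' [t' [[<-] _ h']] /(_ _ h').
  move=> [_ xw] Oz.
  have [U [oU Uxi HU]] := directed_open_ends Xc td adhesion_finite oO xw Oz.
  by exists U; split=> // xi' w' [_ h]; exact: HU.
(* Related points are of the same kind, and the sinks of two resting points are in one orbit, hence
   have the same representative. *)
- move=> i j k k' xi xi' z z' mi mj [g Gg gx].
  case: i j mi mj => [t|] [t'|] mi mj.
  + have := sinks_act Xc td invariant adhesion_finite Gg (msink _ _ _ _ mi).
    rewrite gx => /suniq /(_ (msink _ _ _ _ mj)) gt.
    case: k z mi => [s|] z; last by move=> [].
    case: k' z' mj => [s'|] z'; last by move=> [].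
    by move=> [t1 [[<-] e _]] [t2 [[<-] e' _]]; rewrite -e -e' -gt Hrep.
  + have := sinks_act Xc td invariant adhesion_finite Gg (msink _ _ _ _ mi).
    by rewrite gx => h; have [w /(sdisj _ _ _ h)] := mdir _ _ _ mj.
  + have [w xw] := mdir _ _ _ mi.
    have := directed_act Xc td invariant adhesion_finite Gg xw.
    by rewrite gx => /(sdisj _ _ _ (msink _ _ _ _ mj)).
  + case: k z mi => [s|] z; first by move=> [? []].
    by case: k' z' mj => [s'|] z' //; move=> [? []].
- move=> i j [s|] xi xi' z z' /=.
    move=> [t [_ ts h]] [t' [_ ts' h']].
    rewrite -(E_bag_boundary h h') E_boundary_act //; [exact: (Htr t).1|exact: (Htr t').1].
  by move=> [_ h] [_ h']; exact: E_tree_boundary.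
- by case.
Qed.

End Bound.
End Main.

Theorem mainTheorem1 (X T : graph) (G : set (aut X)) (beta : T -> set X)
    (actT : aut X -> aut T)
    (X_connected : connected_graph X)
    (X_locally_finite : locally_finite X)
    (X_hyperbolic : gromov_hyperbolic X)
    (G_group : group_closed [in G])
    (G_countable : countable G)
    (decomposition : tree_decomposition beta)
    (invariant : invariant_decomposition beta G actT)
    (bags_connected : forall t : T, connected_graph (induced (beta t)))
    (adhesion_finite : forall u v : T, adj u v -> finite_set (adhesion beta u v))
    (edges_cofinite : finite_set (edge_orbits G actT)) :
  (borel_hyperfinite (E_tree G actT) ->
   (forall t : T, borel_hyperfinite (@E_bag X T beta G actT t)) ->
   borel_hyperfinite (E_boundary G))
  /\
  ((forall u v : T, adj u v ->
      (exists w : ends X, end_tails_in w (side beta u v)) /\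
      (exists w : ends X, end_tails_in w (side beta v u))) ->
   borel_hyperfinite (E_boundary G) ->
   borel_hyperfinite (E_tree G actT) /\
   (forall t : T, borel_hyperfinite (@E_bag X T beta G actT t))).
Proof.
have Xc : forall x y : X, reach x y by case: X_connected.
have [D hyp] := hyperbolic_four_point X_hyperbolic.
have [L HL] := adhesion_path_bound G_group invariant adhesion_finite edges_cofinite
  bags_connected.
(* Geodesics of a bag are quasi-geodesics of [X] with constant [L.+1]. *)
have [K HK] := morse_quasi Xc hyp L.+1.
split; first by move=> hT hB; apply: E_boundary_hyperfinite; eassumption.
move=> ends_in hE; split; last by move=> t; apply: E_bag_hyperfinite; eassumption.
apply: E_tree_hyperfinite; try eassumption.
(* A side containing a tail of a ray is infinite, because rays are injective. *)
move=> u v uv fS; have [[w Hw] _] := ends_in u v uv.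
have [r wr] := ends_ex w; have [N HN] := Hw r wr.
have [M HM] := inj_escape (ends_ray wr).1 fS.
by apply: (HM (maxn N M) (leq_maxr _ _)); apply: HN; exact: leq_maxl.
Qed.
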